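(* Let $a=(a_n)_{n\in\mathbb N_0}\in(0,\infty)^{\mathbb N_0}$ and $b=(b_n)_{n\in\mathbb N_0}\in\mathbb C^{\mathbb N_0}$, suppose $J=J(a,b)$ is proper, and let $(\nu,\psi)$ be its spectral data. Then: (i) $J$ is self-adjoint if and only if $\psi(s)\in\mathbb R$ for $\nu$-a.e. $s\ge0$. (ii) $b_n=0$ for all $n\ge0$ if and only if $\psi(s)=0$ for $\nu$-a.e. $s\ge0$.
   Context: $\mathbb N_0=\{0,1,2,\dots\}$; $(\delta_n)_{n\ge0}$ is the standard basis of $\ell^2(\mathbb N_0)$; inner products are linear in the second argument; $\mathcal B_b(\mathbb R)$ is the set of bounded Borel functions on $\mathbb R$. For $a\in(0,\infty)^{\mathbb N_0}$, $b\in\mathbb C^{\mathbb N_0}$ (not assumed bounded), the Jacobi matrix acts on sequences by $(Ju)_n=a_{n-1}u_{n-1}+b_nu_n+a_nu_{n+1}$ (with the $a_{-1}u_{-1}$ term omitted for $n=0$), and $J=J(a,b)$ denotes the operator on $\ell^2(\mathbb N_0)$ with maximal domain $D(J)=\{u\in\ell^2(\mathbb N_0): Ju\in\ell^2(\mathbb N_0)\}$. $J_0(a,b)$ is its restriction to the finitely supported sequences. $J(a,b)$ is proper if $\overline{J_0(a,b)}=J(a,b)$. $|J|=\sqrt{J^*J}$. Spectral data: for proper $J$ there are a unique probability measure $\nu$ on $[0,+\infty)$ and a unique $\psi\in L^\infty(\nu)$ with $|\psi|\le 1$ $\nu$-a.e., normalized by $\psi(0)=0$, such that for all $f\in\mathcal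 B_b(\mathbb R)$ $$\langle\delta_0,f(|J|)\delta_0\rangle=\int_{[0,+\infty)}f\,d\nu,\qquad \langle\delta_0,Jf(|J|)\delta_0\rangle=\int_{[0,+\infty)}sf(s)\psi(s)\,d\nu(s).$$ *)

(* Defs.v *)
From HB Require Import structures.
From mathcomp Require Import all_boot all_order all_algebra.
From mathcomp Require Import all_classical all_reals all_analysis.
From mathcomp.real_closed Require Import complex.

Set Implicit Arguments.
Unset Strict Implicit.
Unset Printing Implicit Defensive.

Import Order.TTheory GRing.Theory Num.Theory.
Import numFieldNormedType.Exports.

Local Open Scope classical_set_scope.
Local Open Scope ring_scope.
Local Open Scope complex_scope.

Definition cseq (R : realType) : Type := nat -> R[i].

Section HilbertSpace.
Context {R : realType}.
Implicit Types u v : cseq R.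

Definition sqnorm_partial u : nat -> R := series (fun n => Normc.normc (u n) ^+ 2).

Definition ell2 : set (cseq R) := [set u | cvgn (sqnorm_partial u)].

Definition l2norm u : R := Num.sqrt (limn (sqnorm_partial u)).

(* Linear in the second argument; meaningful on ell2, where both real series
   converge absolutely. *)
Definition inner u v : R[i] :=
  limn (series (fun n => complex.Re (conjc (u n) * v n)))
  +i* limn (series (fun n => complex.Im (conjc (u n) * v n))).

Definition delta (k : nat) : cseq R := fun n => (n == k)%:R.

End HilbertSpace.

(* Possibly unbounded operators on ell2 are represented by their graphs:
   G (u, w) means that u is in the domain and is mapped to w. *)
Section UnboundedOperators.
Context {R : realType}.
Implicit Types G T : set (cseq R * cseq R).

Definition is_operator G : Prop :=
  [/\ forall u w, G (u, w) -> ell2 u /\ ell2 w,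
      forall (c : R[i]) u w u' w', G (u, w) -> G (u', w') ->
        G ((c \*o u) \+ u', (c \*o w) \+ w')
    & forall u w w', G (u, w) -> G (u, w') -> w = w'].

Definition op_closure G : set (cseq R * cseq R) :=
  [set p | [/\ ell2 p.1, ell2 p.2
    & forall e : R, 0 < e -> exists2 q, G q &
        l2norm (p.1 \- q.1) < e /\ l2norm (p.2 \- q.2) < e]].

(* The graph of the adjoint when G is densely defined. *)
Definition adjoint G : set (cseq R * cseq R) :=
  [set p | [/\ ell2 p.1, ell2 p.2
    & forall u w, G (u, w) -> inner p.1 w = inner p.2 u]].

Definition self_adjoint G : Prop := adjoint G = G.

(* In the order of R[i], 0 <= z means that z is real and nonnegative. *)
Definition positive_op G : Prop := forall u w, G (u, w) -> 0 <= inner u w.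

(* op_comp G T is the graph of "first T, then G", on its natural domain. *)
Definition op_comp G T : set (cseq R * cseq R) :=
  [set p | exists2 v, T (p.1, v) & G (v, p.2)].

(* T is the positive self-adjoint square root of G^* G. *)
Definition is_modulus G T : Prop :=
  [/\ is_operator T, self_adjoint T, positive_op T
    & op_comp T T = op_comp (adjoint G) G].

End UnboundedOperators.

Section SpectralCalculus.
Context {R : realType}.

Definition cintegral (mu : {measure set (measurableTypeR R) -> \bar R})
    (D : set R) (f : R -> R[i]) : R[i] :=
  (\int[mu]_(s in D) complex.Re (f s)) +i* (\int[mu]_(s in D) complex.Im (f s)).

Definition cmeasurable (D : set R) (f : R -> R[i]) : Prop :=
  measurable_fun (D : set (measurableTypeR R)) (fun s => complex.Re (f s)) /\
  measurable_fun (D : set (measurableTypeR R)) (fun s => complex.Im (f s)).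

Definition bounded_borel (f : R -> R[i]) : Prop :=
  cmeasurable setT f /\ exists M : R, forall s, Normc.normc (f s) <= M.

(* A projection-valued Borel measure E on R (resolution of the identity), with
   the scalar measures A |-> <u, E(A) u>.  The value of [spec_proj] outside the
   Borel sets and outside ell2, and of [spec_diag] outside ell2, is irrelevant.
   Countable additivity of E is that of [spec_diag]. *)
Record spectral_measure := SpectralMeasure {
  spec_proj : set (measurableTypeR R) -> cseq R -> cseq R ;
  spec_diag : cseq R -> {measure set (measurableTypeR R) -> \bar R} ;
  spec_proj_ell2 : forall A u,
    measurable A -> ell2 u -> ell2 (spec_proj A u) ;
  spec_proj_linear : forall A (c : R[i]) u v,
    measurable A -> ell2 u -> ell2 v ->
    spec_proj A ((c \*o u) \+ v) = (c \*o spec_proj A u) \+ spec_proj A v ;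
  spec_proj_sym : forall A u v, measurable A -> ell2 u -> ell2 v ->
    inner u (spec_proj A v) = inner (spec_proj A u) v ;
  spec_projI : forall A B u, measurable A -> measurable B -> ell2 u ->
    spec_proj (A `&` B) u = spec_proj A (spec_proj B u) ;
  spec_projT : forall u, ell2 u -> spec_proj setT u = u ;
  spec_diagE : forall A u, measurable A -> ell2 u ->
    spec_diag u A = (complex.Re (inner u (spec_proj A u)))%:E
}.

Definition spec_dom (E : spectral_measure) (f : R -> R[i]) : set (cseq R) :=
  [set u | ell2 u /\
    (\int[spec_diag E u]_s (Normc.normc (f s) ^+ 2)%:E < +oo)%E].

(* The integral of f against the complex measure A |-> <v, E(A) u>, written by
   polarization:
     <v, E(A) u> = 1/4 \sum_(k < 4) i^k <u + i^k v, E(A) (u + i^k v)>. *)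
Definition spec_form (E : spectral_measure) (f : R -> R[i])
    (v u : cseq R) : R[i] :=
  4^-1 * \sum_(k < 4) (0 +i* 1) ^+ k *
    cintegral (spec_diag E (u \+ ((0 +i* 1) ^+ k \*o v))) setT f.

(* The graph of the normal operator \int f dE, with domain spec_dom E f.  The
   domain is dense, so testing against its elements determines the value. *)
Definition spec_integral (E : spectral_measure) (f : R -> R[i]) :
    set (cseq R * cseq R) :=
  [set p | [/\ spec_dom E f p.1, ell2 p.2
    & forall v, spec_dom E f v -> inner v p.2 = spec_form E f v p.1]].

Definition is_spectral_measure_of (T : set (cseq R * cseq R))
    (E : spectral_measure) : Prop :=
  spec_integral E (fun s => s%:C) = T.

End SpectralCalculus.
Arguments spectral_measure : clear implicits.

Section Jacobi.
Context {R : realType}.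
Variables (a : nat -> R) (b : nat -> R[i]).

Definition jacobi_seq (u : cseq R) : cseq R := fun n =>
  (if n is m.+1 then (a m)%:C * u m else 0) + b n * u n + (a n)%:C * u n.+1.

Definition jacobi : set (cseq R * cseq R) :=
  [set p | [/\ ell2 p.1, ell2 p.2 & p.2 = jacobi_seq p.1]].

Definition jacobi0 : set (cseq R * cseq R) :=
  [set p | jacobi p /\ exists N, forall n, (N <= n)%N -> p.1 n = 0].

Definition proper_jacobi : Prop := op_closure jacobi0 = jacobi.

(* (nu, psi) is the spectral data of J; psi is a representative of its class in
   L^infty(nu), and the bound on psi gives its essential boundedness.  T is |J|
   and E is the spectral measure of |J|, so that f(|J|) is spec_integral E f;
   in the last clause w = f(|J|) delta_0 and x = J f(|J|) delta_0. *)
Definition is_spectral_data (nu : probability (measurableTypeR R) R)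
    (psi : R -> R[i]) : Prop :=
  [/\ nu [set` `[0, +oo[] = 1%E,
      cmeasurable `[0, +oo[ psi,
      {ae nu, forall s, 0 <= s -> Normc.normc (psi s) <= 1},
      psi 0 = 0
    & exists (T : set (cseq R * cseq R)) (E : spectral_measure R),
      [/\ is_modulus jacobi T, is_spectral_measure_of T E
        & forall f, bounded_borel f -> exists w x,
          [/\ spec_integral E f (delta 0, w), jacobi (w, x),
              inner (delta 0) w = cintegral nu `[0, +oo[ f
            & inner (delta 0) x =
                cintegral nu `[0, +oo[ (fun s => s%:C * f s * psi s)]]].

End Jacobi.

(* Main.v *)
(* For [c] complex put [v = c J^* delta_0].  The data [psi] gives the density
   [s * Re (conj c * psi s)] of the signed measure
   [A |-> Re <v, E(A) delta_0>] with respect to [nu], where [E] is the spectral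
   measure of [|J|]; so [psi] is real (resp. null) iff this measure vanishes
   for [c = i] (resp. for [c = 1] and [c = i]).

   If it vanishes, then [Re <v, (J^* J)^k delta_0> = 0] for all [k], i.e. the
   [(0, 0)] entries of all the words [J (J^* J)^k] are real (resp. zero).
   Expanding the word of length [2m+1] over lattice paths, the only path that
   sees [b_m] but no later coefficient goes up to [m], makes one flat step and
   comes back, so by induction on [m] all [b_m] are real (resp. zero).

   Conversely, let [V] be the complex conjugation (resp. the diagonal operator
   of signs [(-1)^n]).  It preserves the graph of [J^* J = |J|^2], fixes
   [delta_0] and maps [v] to [-v].  Comparing the growth of [|J|^2n] on both
   sides shows that [V] maps the relevant vectors of the range of
   [E(|s| <= r)] to that range, so [Re <v, E(|s| <= r) delta_0>] equals its
   opposite for all [r], and the measure vanishes.  This avoids polynomial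
   approximation and the uniqueness of square roots. *)

Require Import Defs.
From mathcomp Require Import all_boot all_order all_algebra.
From mathcomp Require Import all_classical all_reals all_analysis.
From mathcomp Require Import measurable_realfun.
From mathcomp.real_closed Require Import complex.
From mathcomp Require Import ring lra zify.

Set Implicit Arguments.
Unset Strict Implicit.

Import Order.TTheory GRing.Theory Num.Theory.
Import numFieldNormedType.Exports.

Local Open Scope classical_set_scope.
Local Open Scope ring_scope.
Local Open Scope complex_scope.

(** * The real part of the inner product on [ell2] *)

Section RealInnerProduct.
Context {R : realType}.
Implicit Types u v w : cseq R.

Definition rip u v : R := complex.Re (inner u v).

Lemma cReM (x y : R[i]) : complex.Re (x * y) =
  complex.Re x * complex.Re y - complex.Im x * complex.Im y.
Proof. by case: x y => [? ?] [? ?]. Qed.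

Lemma cImM (x y : R[i]) : complex.Im (x * y) =
  complex.Re x * complex.Im y + complex.Im x * complex.Re y.
Proof. by case: x y => [? ?] [? ?]. Qed.

Lemma cReD (x y : R[i]) : complex.Re (x + y) = complex.Re x + complex.Re y.
Proof. by case: x y => [? ?] [? ?]. Qed.

Lemma cImD (x y : R[i]) : complex.Im (x + y) = complex.Im x + complex.Im y.
Proof. by case: x y => [? ?] [? ?]. Qed.

Lemma cReN (x : R[i]) : complex.Re (- x) = - complex.Re x.
Proof. by case: x. Qed.

Lemma cImN (x : R[i]) : complex.Im (- x) = - complex.Im x.
Proof. by case: x. Qed.

Lemma cReJ (x : R[i]) : complex.Re (conjc x) = complex.Re x.
Proof. by case: x. Qed.

Lemma cImJ (x : R[i]) : complex.Im (conjc x) = - complex.Im x.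
Proof. by case: x. Qed.

Definition ReImE := (cReM, cImM, cReD, cImD, cReN, cImN, cReJ, cImJ).

Lemma complex_ext (x y : R[i]) : complex.Re x = complex.Re y ->
  complex.Im x = complex.Im y -> x = y.
Proof. by case: x y => [? ?] [? ?] /= -> ->. Qed.

Lemma normc_sqr (z : R[i]) :
  Normc.normc z ^+ 2 = complex.Re z ^+ 2 + complex.Im z ^+ 2.
Proof. by case: z => x y /=; rewrite sqr_sqrtr // addr_ge0 ?sqr_ge0. Qed.

Lemma ell2_le (C : R) u v w :
  (forall n, Normc.normc (w n) ^+ 2 <=
     C * (Normc.normc (u n) ^+ 2 + Normc.normc (v n) ^+ 2)) ->
  ell2 u -> ell2 v -> ell2 w.
Proof.
move=> h hu hv; rewrite /ell2 /sqnorm_partial /=.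
apply: (series_le_cvg _ _ h).
- by move=> n; rewrite sqr_ge0.
- by move=> n; apply: le_trans (h n); rewrite sqr_ge0.
have := is_cvg_seriesZ (k := C) (is_cvg_seriesD hu hv).
by congr (cvgn (series _)).
Qed.

Lemma ell2D u v : ell2 u -> ell2 v -> ell2 (u \+ v).
Proof.
apply: (@ell2_le 2) => n; rewrite !normc_sqr /= !ReImE.
set a := complex.Re (u n); set b := complex.Im (u n).
set c := complex.Re (v n); set d := complex.Im (v n).
have := sqr_ge0 (a - c); have := sqr_ge0 (b - d); nra.
Qed.

Lemma ell2Z (c : R[i]) u : ell2 u -> ell2 (c \*o u).
Proof.
move=> hu; apply: (@ell2_le (Normc.normc c ^+ 2) _ _ _ _ hu hu) => n.
rewrite !normc_sqr /= !ReImE.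
set a := complex.Re c; set b := complex.Im c.
by rewrite -subr_ge0; nra.
Qed.

Lemma is_cvg_inner u v (f : nat -> R) : ell2 u -> ell2 v ->
  (forall n, `|f n| <= Normc.normc (u n) ^+ 2 + Normc.normc (v n) ^+ 2) ->
  cvgn (series f).
Proof.
move=> hu hv hf; apply: normed_cvg.
pose g n := Normc.normc (u n) ^+ 2 + Normc.normc (v n) ^+ 2.
apply: (@series_le_cvg _ _ g) => //.
- by move=> n; rewrite /= normr_ge0.
- by move=> n; rewrite addr_ge0 ?sqr_ge0.
- exact: (is_cvg_seriesD hu hv).
Qed.

Lemma is_cvg_Re_inner u v : ell2 u -> ell2 v ->
  cvgn (series (fun n => complex.Re (conjc (u n) * v n))).
Proof.
move=> hu hv; apply: (is_cvg_inner hu hv) => n.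
rewrite !normc_sqr !ReImE.
set a := complex.Re (u n); set b := complex.Im (u n).
set c := complex.Re (v n); set d := complex.Im (v n).
have := sqr_ge0 (a - c); have := sqr_ge0 (b - d).
have := sqr_ge0 (a + c); have := sqr_ge0 (b + d) => h1 h2 h3 h4.
by rewrite ler_norml; apply/andP; split; nra.
Qed.

Lemma ripDr u v w : ell2 u -> ell2 v -> ell2 w ->
  rip u (v \+ w) = rip u v + rip u w.
Proof.
move=> hu hv hw; rewrite /rip /=.
rewrite -lim_seriesD; [|exact: is_cvg_Re_inner..].
by congr (limn (series _)); apply/funext => n /=; rewrite mulrDr cReD.
Qed.

Lemma ripC u v : rip u v = rip v u.
Proof.
rewrite /rip /=; congr (limn (series _)); apply/funext => n /=.
by rewrite !ReImE; ring.
Qed.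

Lemma ripDl u v w : ell2 u -> ell2 v -> ell2 w ->
  rip (v \+ w) u = rip v u + rip w u.
Proof. by move=> hu hv hw; rewrite !(ripC _ u) ripDr. Qed.

Lemma ripZr (r : R) u v : ell2 u -> ell2 v ->
  rip u (r%:C \*o v) = r * rip u v.
Proof.
move=> hu hv; rewrite /rip /=.
have -> (x : R) : r * x = r *: x by [].
rewrite -lim_seriesZ; last exact: is_cvg_Re_inner.
congr (limn (series _)); apply/funext => n.
rewrite -[RHS]/(r * complex.Re (conjc (u n) * v n)) /= !ReImE /=; ring.
Qed.

Lemma ripZl (r : R) u v : ell2 u -> ell2 v ->
  rip (r%:C \*o u) v = r * rip u v.
Proof. by move=> hu hv; rewrite ripC ripZr // ripC. Qed.

(** The inner product is antilinear in its first argument, so ['i] there contributes a factor [-i].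
    Statements about [inner] thus reduce to the real form [rip]. *)
Lemma Im_inner u v : complex.Im (inner u v) = rip ('i \*o u) v.
Proof.
rewrite /rip /=; congr (limn (series _)); apply/funext => n /=.
by rewrite !ReImE /=; ring.
Qed.

Lemma limn_series_eventually (f : nat -> R) (l : R) N :
  (forall n, (N <= n)%N -> series f n = l) -> limn (series f) = l.
Proof.
move=> h; apply: cvg_lim => //; apply: cvg_near_cst.
by exists N => // n /= hn; rewrite h.
Qed.

Lemma inner_delta k u : inner (delta k) u = u k.
Proof.
have h (g : R[i] -> R) : g 0 = 0 ->
  limn (series (fun n => g (conjc (delta k n) * u n))) = g (u k).
  move=> g0; apply: (@limn_series_eventually _ _ k.+1) => n hn.
  rewrite /series /= (bigD1_seq k) ?mem_index_iota ?iota_uniq //=.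
  rewrite big1 ?addr0 => [|j hj]; rewrite /delta.
    by rewrite eqxx conjc1 mul1r.
  by rewrite (negbTE hj) conjc0 mul0r.
by rewrite /inner (h (@complex.Re R)) // (h (@complex.Im R)) //; case: (u k).
Qed.

Lemma rip_ge0 u : ell2 u -> 0 <= rip u u.
Proof.
move=> hu; apply: limr_ge; first exact: is_cvg_Re_inner.
apply: nearW => n; apply: sumr_ge0 => i _; rewrite !ReImE; nra.
Qed.

Lemma rip_eq0 u : ell2 u -> rip u u = 0 -> u = fun=> 0.
Proof.
move=> hu u0; apply/funext => k.
have hc := is_cvg_Re_inner hu hu.
have h n : 0 <= complex.Re (conjc (u n) * u n) by rewrite !ReImE; nra.
have : series (fun n => complex.Re (conjc (u n) * u n)) k.+1 <= rip u u.
  apply: nondecreasing_cvgn_le => //.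
  by apply: nondecreasing_series => n _ _; exact: h.
rewrite u0 seriesSr.
have : 0 <= series (fun n => complex.Re (conjc (u n) * u n)) k by apply: sumr_ge0.
have := h k; rewrite !ReImE => h0 h1 h2.
have {h0 h1 h2}: complex.Re (u k) ^+ 2 + complex.Im (u k) ^+ 2 = 0.
  by apply/eqP; rewrite eq_le; apply/andP; split; nra.
move/eqP; rewrite paddr_eq0 ?sqr_ge0 // !sqrf_eq0 => /andP[/eqP hr /eqP hi].
by apply: complex_ext.
Qed.

Lemma l2normE u : l2norm u = Num.sqrt (rip u u).
Proof.
rewrite /l2norm /rip /=; congr (Num.sqrt (limn (series _))).
by apply/funext => n; rewrite normc_sqr !ReImE; ring.
Qed.

Lemma rip_lt_l2norm u (e : R) : 0 < e -> ell2 u -> l2norm u < e ->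
  rip u u < e ^+ 2.
Proof.
move=> e0 hu; rewrite l2normE => h.
by rewrite -[ltLHS](sqr_sqrtr (rip_ge0 hu)) ltrXn2r // ?sqrtr_ge0 // ltW.
Qed.

Lemma subfE u v : u \- v = u \+ ((-1)%:C \*o v).
Proof. by apply/funext => n /=; rewrite rmorphN1 mulN1r. Qed.

Lemma ell2B u v : ell2 u -> ell2 v -> ell2 (u \- v).
Proof. by move=> hu hv; rewrite subfE; apply/ell2D/ell2Z. Qed.

Lemma ripBr u v w : ell2 u -> ell2 v -> ell2 w ->
  rip u (v \- w) = rip u v - rip u w.
Proof.
by move=> hu hv hw; rewrite subfE ripDr ?ripZr ?mulN1r //; apply: ell2Z.
Qed.

Lemma ripBl u v w : ell2 u -> ell2 v -> ell2 w ->
  rip (v \- w) u = rip v u - rip w u.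
Proof. by move=> hu hv hw; rewrite !(ripC _ u) ripBr. Qed.

Lemma rip_sqrB u v : ell2 u -> ell2 v ->
  rip (u \- v) (u \- v) = rip u u - 2 * rip u v + rip v v.
Proof.
by move=> hu hv; rewrite ripBr ?ripBl ?(ripC v u) //; [ring|exact: ell2B].
Qed.

Lemma rip_sqrD u v : ell2 u -> ell2 v ->
  rip (u \+ v) (u \+ v) = rip u u + 2 * rip u v + rip v v.
Proof.
by move=> hu hv; rewrite ripDr ?ripDl ?(ripC v u) //; [ring|exact: ell2D].
Qed.

(** Young's inequality: expand the squared norm of [r u - v] and divide by [r]. It does the work of
    Cauchy-Schwarz below. *)
Lemma ler_rip (r : R) u v : 0 < r -> ell2 u -> ell2 v ->
  2 * rip u v <= r * rip u u + r^-1 * rip v v.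
Proof.
move=> r0 hu hv; have hv' := ell2Z (c := r%:C) hu.
have := rip_ge0 (ell2B hv' hv).
rewrite rip_sqrB // ripZl ?ripZr ?ripZl // => h.
rewrite -subr_ge0 -(pmulr_rge0 _ r0); move: h; congr (0 <= _).
field; exact: lt0r_neq0.
Qed.

Lemma rip_scale (c : R[i]) u v : ell2 u -> ell2 v ->
  rip (c \*o u) v = complex.Re (conjc c * inner u v).
Proof.
move=> hu hv; have hiu := ell2Z (c := 'i) hu.
have -> : c \*o u = ((complex.Re c)%:C \*o u) \+
    ((complex.Im c)%:C \*o ('i \*o u)).
  by apply/funext => n /=; apply: complex_ext; rewrite !ReImE /=; ring.
rewrite ripDl ?(ripZl _ hu hv) ?(ripZl _ hiu hv) //; try exact: ell2Z.
by rewrite !ReImE Im_inner /rip mulNr opprK.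
Qed.

Lemma rip_ext u v : ell2 u -> ell2 v ->
  (forall x, ell2 x -> rip x u = rip x v) -> u = v.
Proof.
move=> hu hv h.
have : rip (u \- v) (u \- v) = 0.
  have huv := ell2B hu hv.
  by rewrite ripBr // h // subrr.
move/(rip_eq0 (ell2B hu hv)) => e; apply/funext => n.
by apply/eqP; rewrite -subr_eq0; apply/eqP; apply: (congr1 (@^~ n) e).
Qed.

Lemma ell2_finsupp u N : (forall n, (N <= n)%N -> u n = 0) -> ell2 u.
Proof.
move=> h; rewrite /ell2 /sqnorm_partial /=.
rewrite -(is_cvg_series_restrict N).
apply/cvg_ex; exists 0; apply: cvg_near_cst; apply: nearW => n /=.
rewrite big_nat_cond big1 // => i /andP[/andP[hi _] _].
by rewrite h // Normc.normc0 expr0n.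
Qed.

End RealInnerProduct.

(** * Measures on the line with finite mass and finite second moment *)

Section SecondMoment.
Context {R : realType}.
Implicit Types m : {measure set (measurableTypeR R) -> \bar R}.

Lemma measure_add_appE m m' A :
  (measure_add m m' : {measure set (measurableTypeR R) -> \bar R}) A =
  (m A + m' A)%E.
Proof. exact: measure_addE. Qed.

Definition finite_second_moment m : Prop :=
  (m setT < +oo)%E /\ (\int[m]_s (s ^+ 2)%:E < +oo)%E.

Lemma measurable_sqr :
  measurable_fun (setT : set (measurableTypeR R)) (fun s : R => (s ^+ 2)%:E).
Proof.
by apply/measurable_EFinP; exact: exprn_measurable.
Qed.

(** Domination of [|s|] by [1 + s ^+ 2]. *)
Lemma integrable_id m : finite_second_moment m -> m.-integrable setT EFin.
Proof.
move=> [m1 m2].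
have mg : measurable_fun setT (fun s : measurableTypeR R => (1 + s ^+ 2)%:E).
  apply/measurable_EFinP; apply: measurable_funD; first exact: measurable_cst.
  exact: exprn_measurable.
apply: (@le_integrable _ _ _ m setT measurableT _ (fun s => (1 + s ^+ 2)%:E)).
- exact/measurable_EFinP.
- move=> s _ /=; rewrite lee_fin [leRHS]ger0_norm ?addr_ge0 ?sqr_ge0 //.
  rewrite ler_norml; apply/andP; split.
    by have := sqr_ge0 (s + 1); nra.
  by have := sqr_ge0 (s - 1); nra.
apply/integrableP; split => //.
under eq_integral => s _ do
  rewrite gee0_abs ?lee_fin ?addr_ge0 ?sqr_ge0 // EFinD.
rewrite ge0_integralD //=; last exact: measurable_sqr.
  by rewrite integral_cst // mul1e lte_add_pinfty.
by move=> s _; rewrite lee_fin sqr_ge0.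
Qed.

Lemma finite_second_moment_eq m m' : finite_second_moment m ->
  (forall A, measurable A -> m' A = m A) -> finite_second_moment m'.
Proof.
move=> [m1 m2] h; split; first by rewrite h.
by rewrite (eq_measure_integral m) // => A mA _; exact: h.
Qed.

Lemma finite_second_moment_le m m' : finite_second_moment m ->
  (forall A, measurable A -> (m' A <= m A)%E) -> finite_second_moment m'.
Proof.
move=> [m1 m2] h; split; first by apply: le_lt_trans m1; exact: h.
apply: le_lt_trans m2; apply: ge0_le_measure_integral => //.
  by move=> s; rewrite lee_fin sqr_ge0.
exact: measurable_sqr.
Qed.

Lemma finite_second_momentD m m' : finite_second_moment m ->
  finite_second_moment m' -> finite_second_moment (measure_add m m').
Proof.
move=> [m1 m2] [m1' m2']; split.
  by rewrite measure_add_appE lte_add_pinfty.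
rewrite ge0_integral_measure_add //; last exact: measurable_sqr.
  exact: lte_add_pinfty.
by move=> s _; rewrite lee_fin sqr_ge0.
Qed.

Lemma Rintegral_measure_add m m' : finite_second_moment m ->
  finite_second_moment m' ->
  \int[measure_add m m']_s s = \int[m]_s s + \int[m']_s s.
Proof.
move=> h h'; have ih := integrable_id h; have ih' := integrable_id h'.
rewrite /Rintegral integral_measure_add // fineD //.
  exact: (integrable_fin_num measurableT ih).
exact: (integrable_fin_num measurableT ih').
Qed.

Lemma measure_setC m K : measurable K -> m setT = (m K + m (~` K))%E.
Proof.
move=> mK; rewrite -(setUv K) measureU ?setICr //; exact: measurableC.
Qed.

(** Prepares the two bounds below: for a measure carried by [K] both sides become integrals over
    [K], where the integrands compare pointwise. *)
Lemma Rintegral_id_concentrated (K : set (measurableTypeR R)) (c : R) m :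
  measurable K -> finite_second_moment m -> m (~` K) = 0%E ->
  [/\ \int[m]_s s = \int[m]_(s in K) s,
      c * fine (m setT) = \int[m]_(s in K) c,
      m.-integrable K EFin & m.-integrable K (fun=> c%:E)].
Proof.
move=> mK hm mK0.
have iid := integrable_id hm.
have mKC : measurable (~` K) by exact: measurableC.
have mT : m setT = m K by rewrite (measure_setC _ mK) mK0 adde0.
split.
- by rewrite /Rintegral (negligible_integral mKC _ iid) // setTD setCK.
- by rewrite mT Rintegral_cst.
- exact: (integrableS measurableT).
have fm : (m K < +oo)%E by rewrite -mT; case: hm.
apply/integrableP; split => //.
rewrite -[ltLHS]/(\int[m]_(x in K) cst `|c%:E| x)%E integral_cst //.
by rewrite lte_mul_pinfty // lee_fin.
Qed.

Lemma Rintegral_id_le (K : set (measurableTypeR R)) (c : R) m :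
  measurable K -> finite_second_moment m -> m (~` K) = 0%E ->
  (forall s : R, K s -> s <= c) -> \int[m]_s s <= c * fine (m setT).
Proof.
move=> mK hm /(Rintegral_id_concentrated c mK hm)[-> -> ? ?] hK.
exact: le_Rintegral.
Qed.

Lemma Rintegral_id_ge (K : set (measurableTypeR R)) (c : R) m :
  measurable K -> finite_second_moment m -> m (~` K) = 0%E ->
  (forall s : R, K s -> c <= s) -> c * fine (m setT) <= \int[m]_s s.
Proof.
move=> mK hm /(Rintegral_id_concentrated c mK hm)[-> -> ? ?] hK.
exact: le_Rintegral.
Qed.

End SecondMoment.

(** * Projections of a spectral measure and the operator [\int s dE] *)

Section SpectralProjections.
Context {R : realType}.
Variable E : spectral_measure R.
Implicit Types (u v w : cseq R) (A B : set (measurableTypeR R)).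

Let P := spec_proj E.
Let mu := spec_diag E.
Local Opaque ell2.

Lemma spec_projD A u v : measurable A -> ell2 u -> ell2 v ->
  P A (u \+ v) = P A u \+ P A v.
Proof.
move=> mA hu hv; have := spec_proj_linear E 1 mA hu hv.
have e x : 1 \*o x = x :> cseq R by apply/funext => n /=; rewrite mul1r.
by rewrite !e.
Qed.

Lemma spec_projZ A (c : R[i]) u : measurable A -> ell2 u ->
  P A (c \*o u) = c \*o P A u.
Proof.
(* Linearity is given in the form [c u + v]; writing [c u] as [(c - 1) u + u] avoids computing the
   projection of zero. *)
move=> mA hu; have := spec_proj_linear E (c - 1) mA hu hu.
have e x : ((c - 1) \*o x) \+ x = c \*o x :> cseq R.
  by apply/funext => n /=; ring.
by rewrite !e.
Qed.

Lemma rip_spec_proj A u v : measurable A -> ell2 u -> ell2 v ->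
  rip u (P A v) = rip (P A u) v.
Proof. by move=> mA hu hv; rewrite /rip spec_proj_sym. Qed.

Lemma spec_proj_idem A u : measurable A -> ell2 u -> P A (P A u) = P A u.
Proof. by move=> mA hu; rewrite -[in RHS](setIid A) [RHS]spec_projI. Qed.

Lemma spec_diag_rip A u : measurable A -> ell2 u -> mu u A = (rip u (P A u))%:E.
Proof. exact: spec_diagE. Qed.

Lemma spec_diag_rip_proj A u : measurable A -> ell2 u ->
  mu u A = (rip (P A u) (P A u))%:E.
Proof.
move=> mA hu; rewrite spec_diag_rip // -rip_spec_proj ?spec_proj_idem //.
exact: spec_proj_ell2.
Qed.

Lemma spec_diagT u : ell2 u -> mu u setT = (rip u u)%:E.
Proof. by move=> hu; rewrite spec_diag_rip // /P spec_projT. Qed.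

Lemma spec_diag_proj A B u : measurable A -> measurable B -> ell2 u ->
  mu (P A u) B = mu u (A `&` B).
Proof.
move=> mA mB hu; have hPu := spec_proj_ell2 (s := E) mA hu.
have mAB : measurable (A `&` B) by exact: measurableI.
rewrite !spec_diag_rip_proj //.
by rewrite setIC /P -spec_projI.
Qed.

(** With [spec_diagB] this is polarization: the masses of [A] for [u + v] and [u - v] differ by
    [4 * rip v (P A u)]. *)
Lemma spec_diagD A u v : measurable A -> ell2 u -> ell2 v ->
  mu (u \+ v) A = (rip u (P A u) + rip v (P A v) + 2 * rip v (P A u))%:E.
Proof.
move=> mA hu hv.
have hPu := spec_proj_ell2 (s := E) mA hu.
have hPv := spec_proj_ell2 (s := E) mA hv.
rewrite spec_diag_rip ?spec_projD ?ripDr ?ripDl //; try exact: ell2D.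
by rewrite (rip_spec_proj mA hu hv) (ripC _ v); congr EFin; rewrite -/P; ring.
Qed.

Lemma spec_diag_unit A (c : R[i]) u : Normc.normc c ^+ 2 = 1 ->
  measurable A -> ell2 u -> mu (c \*o u) A = mu u A.
Proof.
move=> c1 mA hu; have hcu := ell2Z (c := c) hu.
rewrite !spec_diag_rip ?spec_projZ //; congr EFin.
rewrite /rip /=; congr (limn (series _)); apply/funext => n.
move: c1; rewrite normc_sqr !ReImE.
set x := complex.Re c; set y := complex.Im c => c1.
rewrite -[RHS]mul1r -c1; ring.
Qed.

Lemma spec_diagB A u v : measurable A -> ell2 u -> ell2 v ->
  mu (u \+ ((-1)%:C \*o v)) A =
  (rip u (P A u) + rip v (P A v) - 2 * rip v (P A u))%:E.
Proof.
move=> mA hu hv; have hNv := ell2Z (c := (-1)%:C) hv.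
have hPu := spec_proj_ell2 (s := E) mA hu.
have hPv := spec_proj_ell2 (s := E) mA hv.
rewrite spec_diagD // spec_projZ // (ripZr _ hNv hPv) (ripZl _ hv hPv).
by rewrite (ripZl _ hv hPu); congr EFin; ring.
Qed.

Lemma normc_sqrN1 : Normc.normc ((-1)%:C : R[i]) ^+ 2 = 1.
Proof. by rewrite normc_sqr /=; ring. Qed.

Lemma normc_sqri : Normc.normc ('i : R[i]) ^+ 2 = 1.
Proof. by rewrite normc_sqr /=; ring. Qed.

(** No mass off [A] means that [rip u u = rip u (P A u)], and then the squared norm of [u - P A u]
    expands to zero. *)
Lemma spec_proj_id A u : measurable A -> ell2 u -> mu u (~` A) = 0%E ->
  P A u = u.
Proof.
move=> mA hu h; have hPu := spec_proj_ell2 (s := E) mA hu.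
have mAC : measurable (~` A) by exact: measurableC.
have : mu u setT = mu u A.
  by rewrite (measure_setC _ mA) h adde0.
rewrite spec_diagT // spec_diag_rip // => -[e].
apply/esym/rip_ext => // x hx.
suff : rip (u \- P A u) (u \- P A u) = 0.
  move/(rip_eq0 (ell2B hu hPu)) => e0.
  have -> : P A u = u; last by [].
  apply/funext => n; apply/eqP; rewrite eq_sym -subr_eq0; apply/eqP.
  exact: (congr1 (@^~ n) e0).
rewrite rip_sqrB // -(rip_spec_proj mA hu) ?spec_proj_idem // e -/P; ring.
Qed.

Lemma spec_diag_projC A u : measurable A -> ell2 u -> P A u = u ->
  mu u (~` A) = 0%E.
Proof.
move=> mA hu <-; rewrite spec_diag_proj //; last exact: measurableC.
by rewrite setICr measure0.
Qed.

(** The domain of [\int s dE], phrased through moments of the scalar measures. *)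
Definition spec_moment u : Prop := ell2 u /\ finite_second_moment (mu u).

Lemma spec_momentP u : spec_moment u <-> spec_dom E (fun s => s%:C) u.
Proof.
have e : (\int[mu u]_s (Normc.normc (s%:C : R[i]) ^+ 2)%:E =
    \int[mu u]_s (s ^+ 2)%:E)%E.
  by apply: eq_integral => s _; rewrite normc_sqr /= expr0n addr0.
split=> [[hu [h1 h2]]|[hu h]]; split => //; first by rewrite e.
by split; [rewrite spec_diagT ?ltry|rewrite -e].
Qed.

(** Since the squared norm of [P A (u - v)] is nonnegative, [mu (u + v)] is at most
    [2 mu u + 2 mu v]. *)
Lemma spec_momentD u v : spec_moment u -> spec_moment v -> spec_moment (u \+ v).
Proof.
move=> [hu mu_u] [hv mu_v]; split; first exact: ell2D.
apply: (@finite_second_moment_le _ (measure_add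
  (measure_add (mu u) (mu u)) (measure_add (mu v) (mu v)))).
  by do !apply: finite_second_momentD.
move=> A mA; rewrite !measure_add_appE spec_diagD // !spec_diag_rip //.
rewrite -!EFinD lee_fin.
have hPu := spec_proj_ell2 (s := E) mA hu.
have hPv := spec_proj_ell2 (s := E) mA hv.
have := rip_ge0 (ell2B hPu hPv); rewrite rip_sqrB //.
rewrite -!rip_spec_proj // !spec_proj_idem //.
rewrite (rip_spec_proj mA hu hv) (ripC _ v) -/P.
lra.
Qed.

Lemma spec_moment_unit (c : R[i]) u : Normc.normc c ^+ 2 = 1 ->
  spec_moment u -> spec_moment (c \*o u).
Proof.
move=> c1 [hu h]; split; first exact: ell2Z.
by apply: (finite_second_moment_eq h) => A mA; rewrite spec_diag_unit.
Qed.

Lemma spec_moment_proj A u : measurable A -> spec_moment u ->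
  spec_moment (P A u).
Proof.
move=> mA [hu h]; split; first exact: spec_proj_ell2.
apply: (finite_second_moment_le h) => B mB; rewrite spec_diag_proj //.
by apply: le_measure; rewrite ?inE //; exact: measurableI.
Qed.

(* The real part of the sesquilinear form of [\int g dE], for real [g]. *)
Definition spec_rform (g : R -> R) v u : R :=
  4^-1 * (\int[mu (u \+ v)]_s g s - \int[mu (u \+ ((-1)%:C \*o v))]_s g s).

(** In the four-term polarization sum, [k = 0, 2] give the real part, and [k = 1, 3] give the same
    expression with [i v] in place of [v]. *)
Lemma spec_formE (g : R -> R) v u : spec_form E (fun s => (g s)%:C) v u =
  spec_rform g v u +i* spec_rform g ('i \*o v) u.
Proof.
have c m : cintegral m setT (fun s => (g s)%:C) = (\int[m]_s g s)%:C.
  by rewrite /cintegral /= Rintegral_cst // mul0r.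
rewrite /spec_form !big_ord_recl big_ord0 !c.
have -> : u \+ 'i ^+ (ord0 : 'I_4) \*o v = u \+ v.
  by apply/funext => n /=; rewrite expr0 mul1r.
have -> : u \+ 'i ^+ (lift ord0 ord0 : 'I_4) \*o v = u \+ 'i \*o v.
  by apply/funext => n /=; rewrite expr1.
have -> : u \+ 'i ^+ (lift ord0 (lift ord0 ord0) : 'I_4) \*o v =
    u \+ (-1)%:C \*o v.
  by apply/funext => n /=; rewrite sqr_i rmorphN1.
have -> : u \+ 'i ^+ (lift ord0 (lift ord0 (lift ord0 ord0)) : 'I_4) \*o v =
    u \+ (-1)%:C \*o ('i \*o v).
  by apply/funext => n /=; rewrite rmorphN1 exprSr sqr_i; ring.
rewrite /spec_rform -/mu.
move: (Rintegral _ _ _) (Rintegral _ _ _) (Rintegral _ _ _) (Rintegral _ _ _).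
move=> x1 x2 x3 x4 /=; rewrite expr0 expr1 sqr_i exprSr sqr_i.
have -> : 4^-1 = (4^-1)%:C :> R[i] by rewrite fmorphV rmorph_nat.
by apply: complex_ext; rewrite !ReImE /=; ring.
Qed.

(** Real parts suffice for testing because the domain is stable under multiplication by ['i]. *)
Lemma spec_graphP u w : spec_integral E (fun s => s%:C) (u, w) <->
  [/\ spec_moment u, ell2 w &
      forall v, spec_moment v -> rip v w = spec_rform id v u].
Proof.
split=> -[/spec_momentP hu hw h]; split => //.
  move=> v /spec_momentP hv; have := h v hv.
  by move=> e; rewrite /rip e (spec_formE id).
move=> v /spec_momentP hv.
rewrite (spec_formE id); apply: complex_ext => /=; first exact: h.
rewrite -[LHS]/(complex.Im (inner v w)) Im_inner; apply: h.
exact: (spec_moment_unit normc_sqri).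
Qed.

Lemma Rintegral_indicT m A : measurable A ->
  \int[m]_s (\1_A s : R) =
  fine ((m : {measure set (measurableTypeR R) -> \bar R}) A).
Proof. by move=> mA; rewrite /Rintegral integral_indic // setIT. Qed.

(** For an indicator the form is a polarized difference of masses of [A], which is
    [rip v (P A u)]. *)
Lemma spec_integral_indic A u w : measurable A ->
  spec_integral E (fun s => (\1_A s)%:C) (u, w) -> w = P A u.
Proof.
move=> mA [[/= hu _] hw h].
have hP := spec_proj_ell2 (s := E) mA hu.
have mAT : measurable_fun [set: measurableTypeR R]
    (fun s => (\1_A s ^+ 2)%:E : \bar R).
  apply/measurable_EFinP; apply: measurable_funX.
  exact: measurable_indic.
apply: rip_ext => // v hv.
have -> : rip v w = spec_rform (\1_A) v u.
  rewrite /rip h ?spec_formE //.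
  split => //.
  (* An indicator is bounded by [1] and [mu v] is finite, so every [v] in [ell2] is an admissible
     test vector. *)
  apply: (@le_lt_trans _ _ (\int[mu v]_s (cst 1 s))%E); last first.
    by rewrite integral_cst // mul1e spec_diagT // ltry.
  apply: ge0_le_integral => //.
  - by move=> s _; rewrite lee_fin sqr_ge0.
  - move: mAT; congr measurable_fun; apply/funext => s.
    by rewrite normc_sqr /= expr0n addr0.
  - move=> s _; rewrite normc_sqr /= expr0n addr0 lee_fin indicE.
    by case: (_ \in _); rewrite ?expr1n ?expr0n.
rewrite /spec_rform !Rintegral_indicT // (spec_diagD mA hu hv).
by rewrite (spec_diagB mA hu hv) /=; lra.
Qed.

(** The operator commutes with the projections: [P A] moves from the test vector to [u] because [rip
    (P A v) (P B u) = rip v (P B (P A u))] for every [B]. *)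
Lemma spec_graph_proj A u w : measurable A ->
  spec_integral E (fun s => s%:C) (u, w) ->
  spec_integral E (fun s => s%:C) (P A u, P A w).
Proof.
move=> mA /spec_graphP[hu hw h]; apply/spec_graphP.
have hPu := spec_moment_proj mA hu.
split=> //; first exact: spec_proj_ell2.
move=> v hv; have hPv := spec_moment_proj mA hv.
have hN x : spec_moment x -> spec_moment ((-1)%:C \*o x).
  exact/spec_moment_unit/normc_sqrN1.
have [eu _] := hu; have [ev _] := hv; have [ePu _] := hPu; have [ePv _] := hPv.
rewrite (rip_spec_proj mA ev hw) (h _ hPv) /spec_rform; congr (_ * _).
(* Differences of integrals are rearranged into sums, so that both sides are integrals against a sum
   of positive measures. *)
apply/eqP; rewrite subr_eq addrAC eq_sym subr_eq; apply/eqP.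
have [_ m1] := spec_momentD hPu (hN _ hv).
have [_ m2] := spec_momentD hPu hv.
have [_ m3] := spec_momentD hu (hN _ hPv).
have [_ m4] := spec_momentD hu hPv.
rewrite -(Rintegral_measure_add m2 m3) -(Rintegral_measure_add m4 m1).
congr fine; apply: eq_measure_integral => B mB _.
rewrite !measure_add_appE (spec_diagD mB ePu ev) (spec_diagB mB ePu ev).
rewrite (spec_diagD mB eu ePv) (spec_diagB mB eu ePv).
have -> : rip (P A v) (P B u) = rip v (P B (P A u)).
  rewrite -(rip_spec_proj mA ev (spec_proj_ell2 mB eu)).
  by rewrite /P -!spec_projI // setIC.
by rewrite -!EFinD; congr EFin; ring.
Qed.

(** Orthogonality to all [P B u] makes the measures of [u + P A v] and [u - P A v] equal, so the
    form at [P A v] vanishes. Iterated, this carries orthogonality along the powers of the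
    operator. *)
Lemma spec_graph_orth u w v : spec_moment v ->
  (forall A, measurable A -> rip v (P A u) = 0) ->
  spec_integral E (fun s => s%:C) (u, w) ->
  forall A, measurable A -> rip v (P A w) = 0.
Proof.
move=> hv h huw A mA; have hPv := spec_moment_proj mA hv.
have /spec_graphP[hu hw hg] := huw.
have [eu _] := hu; have [ev _] := hv; have [ePv _] := hPv.
rewrite (rip_spec_proj mA ev hw) (hg _ hPv) /spec_rform.
suff -> : Rintegral (mu (u \+ P A v)) setT id =
    Rintegral (mu (u \+ (-1)%:C \*o P A v)) setT id by rewrite subrr mulr0.
congr fine; apply: eq_measure_integral => B mB _.
rewrite (spec_diagD mB eu ePv) (spec_diagB mB eu ePv).
have -> : rip (P A v) (P B u) = 0.
  rewrite -(rip_spec_proj mA ev (spec_proj_ell2 mB eu)).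
  by rewrite /P -spec_projI // -/P h //; exact: measurableI.
by congr EFin; ring.
Qed.

End SpectralProjections.

(** * Growth of the powers of [T^2] and symmetries commuting with [T^2] *)

Section Growth.
Context {R : realType}.
Variables (E : spectral_measure R) (T : set (cseq R * cseq R)).
Hypotheses (opT : is_operator T) (ET : is_spectral_measure_of T E).
Implicit Types (u v w : cseq R) (A B K : set (measurableTypeR R)).

Let P := spec_proj E.
Let mu := spec_diag E.
Local Opaque ell2.

Lemma operatorZ (c : R[i]) u w : T (u, w) -> T (c \*o u, c \*o w).
Proof.
have [_ lin _] := opT => huw; have := lin (c - 1) _ _ _ _ huw huw.
have e x : ((c - 1) \*o x) \+ x = c \*o x :> cseq R.
  by apply/funext => n /=; ring.
by rewrite !e.
Qed.

Lemma operator_proj A u w : measurable A -> T (u, w) -> T (P A u, P A w).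
Proof. by rewrite -ET; exact: spec_graph_proj. Qed.

Lemma operator_moment u w : T (u, w) -> spec_moment E u.
Proof. by rewrite -ET => /spec_graphP[]. Qed.

Lemma operator_ell2 u w : T (u, w) -> ell2 u /\ ell2 w.
Proof. by have [h _ _] := opT; exact: h. Qed.

Lemma operator_rip u w v : T (u, w) -> spec_moment E v ->
  rip v w = spec_rform E id v u.
Proof. by rewrite -ET => /spec_graphP[_ _]; apply. Qed.

Lemma operator_concentrated K u v : measurable K -> ell2 u -> ell2 v ->
  P K u = u -> P K v = v ->
  mu (u \+ v) (~` K) = 0%E /\ mu (u \+ (-1)%:C \*o v) (~` K) = 0%E.
Proof.
move=> mK hu hv eu ev; have hNv := ell2Z (c := (-1)%:C) hv.
split; apply: spec_diag_projC => //; rewrite ?spec_projD ?spec_projZ //.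
- exact: ell2D.
- by rewrite -/P eu ev.
- exact: ell2D.
- by rewrite -/P eu ev.
Qed.

(** Testing [T (a u) = a w] against [w] bounds [a |w|^2] by [a / 4] times the sum of [|a u + w|^2]
    and [|a u - w|^2], which is [a / 2 * (a^2 |u|^2 + |w|^2)]. Scaling [u] by [a] balances the two
    terms. *)
Lemma operator_upper (a : R) K u w : measurable K -> 0 < a ->
  (forall s : R, K s -> `|s| <= a) -> T (u, w) -> spec_moment E w ->
  P K u = u -> P K w = w -> rip w w <= a ^+ 2 * rip u u.
Proof.
move=> mK a0 hK huw hw eu ew.
have [lu lw] := operator_ell2 huw.
have haw := operatorZ a%:C huw.
have lau := ell2Z (c := a%:C) lu.
have eau : P K (a%:C \*o u) = a%:C \*o u by rewrite /P spec_projZ // -/P eu.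
have := operator_rip haw hw; rewrite (ripZr _ lw lw).
have [c1 c2] := operator_concentrated mK lau lw eau ew.
have [l1 m1] := spec_momentD (operator_moment haw) hw.
have [l2 m2] := spec_momentD (operator_moment haw)
  (spec_moment_unit (normc_sqrN1 (R := R)) hw).
have le1 (s : R) : K s -> s <= a by move=> /hK; rewrite ler_norml => /andP[].
have ge1 (s : R) : K s -> - a <= s by move=> /hK; rewrite ler_norml => /andP[].
have := Rintegral_id_le mK m1 c1 le1.
have := Rintegral_id_ge mK m2 c2 ge1.
rewrite (spec_diagT E l1) (spec_diagT E l2) /spec_rform /= -subfE.
rewrite rip_sqrB // rip_sqrD // !ripZl ?ripZr ?ripZl //.
set i1 := Rintegral _ _ _; set i2 := Rintegral _ _ _ => h2 h1 e.
suff : 0 <= a * (a ^+ 2 * rip u u - rip w w) by rewrite pmulr_rge0 // subr_ge0.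
by move: h2 h1 e; nra.
Qed.

(** On such a range [<u, T u>] is at least [b |u|^2] (resp. at most [- b |u|^2]); expanding the
    square of [w - b u] (resp. [w + b u]) then bounds [|w|^2] from below. *)
Lemma operator_lower (b : R) B u w : measurable B -> 0 < b ->
  (forall s : R, B s -> b <= s) \/ (forall s : R, B s -> s <= - b) ->
  T (u, w) -> P B u = u -> b ^+ 2 * rip u u <= rip w w.
Proof.
move=> mB b0 hB huw eu.
have [lu lw] := operator_ell2 huw.
have mu_u := operator_moment huw.
have := operator_rip huw mu_u.
have [c1 _] := operator_concentrated mB lu lu eu eu.
have [l1 m1] := spec_momentD mu_u mu_u.
have [l2 m2] := spec_momentD mu_u
  (spec_moment_unit (normc_sqrN1 (R := R)) mu_u).
(* In [spec_rform] at [(u, u)] the second measure belongs to [u - u]; it is zero, hence carried by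
   the empty set, and its integral drops out. *)
have c2 : mu (u \+ (-1)%:C \*o u) (~` set0) = 0%E.
  by rewrite setC0 /mu spec_diagT // -subfE rip_sqrB //; congr EFin; ring.
have n2 : rip (u \- u) (u \- u) = 0 by rewrite rip_sqrB //; ring.
have i2 : \int[mu (u \+ (-1)%:C \*o u)]_s s = 0.
  apply/eqP; rewrite eq_le.
  have := @Rintegral_id_le _ _ 0 _ measurable0 m2 c2 (fun _ => False_ind _).
  have := @Rintegral_id_ge _ _ 0 _ measurable0 m2 c2 (fun _ => False_ind _).
  by rewrite !mul0r => -> ->.
rewrite /spec_rform i2 subr0.
have h4 : fine (mu (u \+ u) setT) = 4 * rip u u.
  by rewrite /mu (spec_diagT E l1) /= rip_sqrD //; ring.
case: hB => hB.
- have := Rintegral_id_ge mB m1 c1 hB; rewrite -/mu h4 => h e.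
  have hbu := ell2Z (c := b%:C) lu.
  have := rip_ge0 (ell2B lw hbu); rewrite rip_sqrB // !ripZl ?ripZr //.
  rewrite (ripC w u); nra.
- have := Rintegral_id_le mB m1 c1 hB; rewrite -/mu h4 => h e.
  have hbu := ell2Z (c := b%:C) lu.
  have := rip_ge0 (ell2D lw hbu); rewrite rip_sqrD // !ripZl ?ripZr //.
  rewrite (ripC w u); nra.
Qed.

Lemma rip_proj_le A u : measurable A -> ell2 u -> rip (P A u) (P A u) <= rip u u.
Proof.
move=> mA hu; rewrite -lee_fin -(spec_diag_rip_proj E mA hu) -(spec_diagT E hu).
by apply: le_measure; rewrite ?inE.
Qed.

Let S := op_comp T T.

Lemma op_comp_upper (a : R) K u w : measurable K -> 0 < a ->
  (forall s : R, K s -> `|s| <= a) -> S (u, w) -> spec_moment E w ->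
  S (P K u, P K w) /\
  rip (P K w) (P K w) <= a ^+ 4 * rip (P K u) (P K u).
Proof.
move=> mK a0 hK [t /= hut htw] hw.
have hu' := operator_proj mK hut; have ht' := operator_proj mK htw.
have [lu lt] := operator_ell2 hut; have [_ lw] := operator_ell2 htw.
split; first by exists (P K t).
have mw := spec_moment_proj mK hw.
have i1 := operator_upper mK a0 hK hu' (operator_moment ht')
  (spec_proj_idem E mK lu) (spec_proj_idem E mK lt).
have i2 := operator_upper mK a0 hK ht' mw
  (spec_proj_idem E mK lt) (spec_proj_idem E mK lw).
apply: le_trans i2 _; rewrite (exprD a 2 2) -mulrA ler_wpM2l ?sqr_ge0 //.
Qed.

Lemma op_comp_lower (b : R) B u w : measurable B -> 0 < b ->
  (forall s : R, B s -> b <= s) \/ (forall s : R, B s -> s <= - b) ->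
  S (u, w) -> b ^+ 4 * rip (P B u) (P B u) <= rip (P B w) (P B w).
Proof.
move=> mB b0 hB [t /= hut htw].
have hu' := operator_proj mB hut; have ht' := operator_proj mB htw.
have [lu lt] := operator_ell2 hut.
have i1 := operator_lower mB b0 hB hu' (spec_proj_idem E mB lu).
have i2 := operator_lower mB b0 hB ht' (spec_proj_idem E mB lt).
apply: le_trans i2; rewrite (exprD b 2 2) -mulrA ler_wpM2l ?sqr_ge0 //.
Qed.

(** Here [c <= (a / b) ^+ n * d], and the right-hand side tends to zero. *)
Lemma le0_of_geometric (a b c d : R) : 0 < a -> a < b ->
  (forall n, b ^+ n * c <= a ^+ n * d) -> c <= 0.
Proof.
move=> a0 ab h; have b0 := lt_trans a0 ab.
have q1 : `|a / b| < 1.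
  by rewrite ger0_norm ?divr_ge0 ?ltW // ltr_pdivrMr // mul1r.
have cv : (a / b) ^+ n * d @[n --> \oo] --> 0 * d.
  apply: cvgM; [exact: cvg_expr|exact: cvg_cst].
rewrite mul0r in cv; rewrite -(cvg_lim _ cv) //.
apply: limr_ge; first by apply/cvg_ex; exists 0.
apply: nearW => n; rewrite expr_div_n mulrAC ler_pdivlMr ?exprn_gt0 //.
by rewrite mulrC.
Qed.

(** The intended [V] are complex conjugation and the signs [(-1)^n]. Symmetry is asked for the real
    form [rip] because conjugation is antilinear. *)
Variable V : cseq R -> cseq R.
Hypotheses (V_ell2 : forall u, ell2 u -> ell2 (V u))
  (V_sym : forall u v, rip (V u) v = rip u (V v))
  (V_inv : forall u, V (V u) = u)
  (V_S : forall u w, S (u, w) -> S (V u, V w)).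

(* [T^2n] grows at most like [a^2n] on the range of [E(|s| <= a)], and [V]
   commutes with [T^2n], whereas it grows at least like [b^2n] on that of
   [E(s >= b)]. *)
Lemma proj_growth (x : nat -> cseq R) (a b : R) K B :
  (forall n, S (x n, x n.+1)) -> measurable K -> measurable B ->
  0 < a -> a < b -> (forall s : R, K s -> `|s| <= a) ->
  (forall s : R, B s -> b <= s) \/ (forall s : R, B s -> s <= - b) ->
  mu (V (P K (x 0%N))) B = 0%E.
Proof.
move=> hx mK mB a0 ab hK hB; have b0 := lt_trans a0 ab.
have lx n : ell2 (x n) by have [t /= /operator_ell2[]] := hx n.
have mx n : spec_moment E (x n) by have [t /= /operator_moment] := hx n.
have step n := op_comp_upper mK a0 hK (hx n) (mx n.+1).
pose y n := P K (x n); pose z n := V (y n).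
have ly n : ell2 (y n) by exact: spec_proj_ell2.
have lz n : ell2 (z n) by exact: V_ell2.
have hz n : S (z n, z n.+1) by apply: V_S; case: (step n).
have Ny n : rip (y n) (y n) <= (a ^+ 4) ^+ n * rip (y 0%N) (y 0%N).
  elim: n => [|n IH]; first by rewrite expr0 mul1r.
  apply: (le_trans (step n).2); rewrite (exprS (a ^+ 4)) -mulrA.
  by apply: ler_wpM2l IH; rewrite exprn_ge0 ?ltW.
have Nz n : (b ^+ 4) ^+ n * rip (P B (z 0%N)) (P B (z 0%N)) <=
    rip (P B (z n)) (P B (z n)).
  elim: n => [|n IH]; first by rewrite expr0 mul1r.
  apply: le_trans (op_comp_lower mB b0 hB (hz n)).
  rewrite (exprS (b ^+ 4)) -mulrA.
  by apply: ler_wpM2l IH; rewrite exprn_ge0 ?ltW.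
rewrite /mu (spec_diag_rip_proj E mB (lz 0%N)).
suff -> : rip (P B (z 0%N)) (P B (z 0%N)) = 0 by [].
apply/eqP; rewrite eq_le.
rewrite [X in _ && X]rip_ge0 ?andbT; last exact: spec_proj_ell2.
apply: (@le0_of_geometric (a ^+ 4) (b ^+ 4) _ (rip (y 0%N) (y 0%N))).
- by rewrite exprn_gt0.
- by rewrite ltrXn2r // ltW.
move=> n; apply: le_trans (Nz n) _.
apply: (le_trans (rip_proj_le mB (lz n))).
by rewrite /z V_sym V_inv.
Qed.

(** The vectors in the domain of every power of [T^2], given with their iterates. *)
Definition smooth u : Prop :=
  exists2 x : nat -> cseq R, x 0%N = u & forall n, S (x n, x n.+1).

Lemma smooth_ell2 u : smooth u -> ell2 u.
Proof. by move=> [x <- /(_ 0%N)] [t /= /operator_ell2[]]. Qed.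

Definition abs_le (r : R) : set (measurableTypeR R) := [set s : R | `|s| <= r].

Lemma measurable_abs_le r : measurable (abs_le r).
Proof.
rewrite [abs_le r](_ : _ = `[- r, r]%classic) //.
by apply/seteqP; split=> s; rewrite /abs_le /= in_itv /= ler_norml.
Qed.

(** Off [|s| <= r] the line is a countable union of half-lines at distance [r + 1/(n+1)] from zero,
    and [proj_growth] makes each of them null for the image under [V]. *)
Lemma proj_commute u r : smooth u -> 0 <= r ->
  P (abs_le r) (V (P (abs_le r) u)) = V (P (abs_le r) u).
Proof.
move=> ou r0; have mK := measurable_abs_le r; have lu := smooth_ell2 ou.
have [x xu hx] := ou.
set z := V (P (abs_le r) u).
have lz : ell2 z by apply: V_ell2; exact: spec_proj_ell2.
apply: spec_proj_id => //.
have mKC : measurable (~` abs_le r) by exact: measurableC.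
pose b n : R := r + n.+1%:R^-1.
pose Bp n : set (measurableTypeR R) := `[b n, +oo[%classic.
pose Bm n : set (measurableTypeR R) := `]-oo, - b n]%classic.
have bn n : 0 < n.+1%:R^-1 :> R by rewrite invr_gt0.
have growth n B : measurable B ->
    (forall s : R, B s -> b n <= s) \/ (forall s : R, B s -> s <= - b n) ->
    (mu z).-negligible B.
  move=> mB hB; apply/negligibleP => //.
  (* The midpoint of [r] and [b n] is positive even for [r = 0], and lies strictly below [b n]. *)
  rewrite /z -xu; apply: (proj_growth (a := (r + b n) / 2) hx mK mB _ _ _ hB).
  - by have := bn n; rewrite /b; move: (_^-1) => e; lra.
  - by have := bn n; rewrite /b; move: (_^-1) => e; lra.
  - by move=> s; rewrite /abs_le /= /b; have := bn n; move: (_^-1) => e; lra.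
apply/negligibleP => //.
apply: (@negligibleS _ _ _ _ (\bigcup_n (Bp n `|` Bm n))); last first.
  apply: negligible_bigcup => n; apply: negligibleU.
  - apply: (growth n); [exact: measurable_itv|left] => s.
    by rewrite /Bp /= in_itv /= andbT.
  - apply: (growth n); [exact: measurable_itv|right] => s.
    by rewrite /Bm /= in_itv.
move=> s; rewrite /abs_le /= => /negP; rewrite -ltNge => rs.
have [n hn] : exists n, n.+1%:R^-1 < `|s| - r.
  exists (Num.trunc (`|s| - r)^-1).
  rewrite invf_plt ?posrE ?subr_gt0 //.
  exact: truncnS_gt.
exists n => //; rewrite /Bp /Bm /= !in_itv /= andbT /b.
have [s0|s0] := lerP 0 s.
  by left; move: hn; rewrite ger0_norm //; move: (_^-1) => e; lra.
by right; move: hn; rewrite ltr0_norm //; move: (_^-1) => e; lra.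
Qed.

(* Moving [V] across, [rip v (P K (V (P K u)))] is both [rip v (P K u)] and its
   opposite. *)
Lemma rip_proj_antisym u v r : smooth u -> smooth v -> 0 <= r ->
  V u = u -> V v = (-1)%:C \*o v -> rip v (P (abs_le r) u) = 0.
Proof.
move=> ou ov r0 Vu Vv; have mK := measurable_abs_le r.
have lu := smooth_ell2 ou; have lv := smooth_ell2 ov.
set K := abs_le r; rewrite -/K in mK.
have lPu := spec_proj_ell2 (s := E) mK lu.
have lPv := spec_proj_ell2 (s := E) mK lv.
have e1 : rip v (P K (V (P K u))) = - rip v (P K u).
  rewrite proj_commute // -V_sym Vv (ripZl _ lv lPu); ring.
have e2 : rip v (P K (V (P K u))) = rip v (P K u).
  rewrite (rip_spec_proj E mK lv (V_ell2 lPu)) -V_sym.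
  rewrite -/P (rip_spec_proj E mK (V_ell2 lPv) lu) -/P proj_commute //.
  by rewrite V_sym Vu (rip_spec_proj E mK lv lu).
by move: e1; rewrite e2; lra.
Qed.

(** The measures of [u + v] and [u - v], pushed forward by [|s|], agree on half-lines by
    [rip_proj_antisym], hence on all Borel sets. Only symmetric sets are reached, as [abs_le r] does
    not separate [s] from [-s]. *)
Lemma rip_proj_abs_antisym u v : smooth u -> smooth v ->
  V u = u -> V v = (-1)%:C \*o v ->
  forall A, measurable A -> rip v (P ([set s : R | A `|s|] : set R) u) = 0.
Proof.
move=> ou ov Vu Vv A mA.
have lu := smooth_ell2 ou; have lv := smooth_ell2 ov.
pose abs : measurableTypeR R -> measurableTypeR R := Num.norm.
have mabs : measurable_fun setT abs by exact: normr_measurable.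
(* Polarization turns the vanishing of a signed quantity into equality of two positive measures, to
   which uniqueness of measures applies. *)
have eq_mu B : measurable B ->
    rip v (P B u) = 0 <-> mu (u \+ v) B = mu (u \+ (-1)%:C \*o v) B.
  move=> mB; rewrite /mu (spec_diagD E mB lu lv) (spec_diagB E mB lu lv) -/P.
  by split=> [->|[]]; [congr EFin; ring|lra].
have mpre B : measurable B -> measurable (abs @^-1` B).
  by move=> mB; rewrite -[X in measurable X]setTI; exact: mabs.
apply/eq_mu; first exact: mpre.
pose m1 : {measure set (measurableTypeR R) -> \bar R} :=
  pushforward (mu (u \+ v)) abs.
pose m2 : {measure set (measurableTypeR R) -> \bar R} :=
  pushforward (mu (u \+ (-1)%:C \*o v)) abs.
have : m1 mabs A = m2 mabs A; last by [].
pose G := @RGenOInfty.G R; pose g n : set R := `](- n%:R : R), +oo[%classic.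
have fin_mu w B : ell2 w -> measurable B -> (mu w B < +oo)%E.
  by move=> lw mB; rewrite /mu (spec_diag_rip E mB lw) ltry.
have lD := ell2D lu lv.
refine (@measure_unique _ R (measurableTypeR R) G g _ _ _ _
  (m1 mabs) (m2 mabs) _ _ A mA).
- exact: RGenOInfty.measurableE.
- move=> _ _ [x ->] [y ->]; exists (Num.max x y).
  by apply/seteqP; split=> s; rewrite /= !in_itv /= !andbT gt_max => /andP.
- by move=> n; exists (- n%:R).
- apply/seteqP; split=> // s _; exists (Num.trunc `|s|).+1 => //.
  rewrite /g /= in_itv /= andbT ltrNl.
  apply: le_lt_trans (truncnS_gt _); by rewrite -normrN ler_norm.
- move=> _ [x ->]; rewrite /m1 /m2 /= /pushforward.
  have mB : measurable (`]x, +oo[%classic : set (measurableTypeR R)).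
    exact: measurable_itv.
  apply/eq_mu; first exact: mpre.
  have rvu : rip v u = 0.
    by have := V_sym v u; rewrite Vu Vv (ripZl _ lv lu); lra.
  (* For [x < 0] the preimage is the whole line, where the claim is [rip v u = 0]; for [x >= 0] it
     is the complement of [abs_le x]. *)
  have [x0|x0] := ltrP x 0.
    have -> : abs @^-1` `]x, +oo[ = [set: R].
      apply/seteqP; split=> // s _ /=.
      by rewrite /abs in_itv /= andbT (lt_le_trans x0).
    by rewrite /P spec_projT.
  have mK := measurable_abs_le x.
  have -> : abs @^-1` `]x, +oo[ = ~` abs_le x.
    apply/seteqP; split=> s; rewrite /abs_le /abs /=;
      by rewrite in_itv /= andbT ltNge => /negP.
  have mKC : measurable (~` abs_le x) by exact: measurableC.
  have /(eq_mu _ mK) e := rip_proj_antisym ou ov x0 Vu Vv.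
  have /(eq_mu _ measurableT) : rip v (P setT u) = 0 by rewrite /P spec_projT.
  rewrite !(measure_setC _ mK) e => h; apply/(eq_mu _ mKC).
  have lB := ell2D lu (ell2Z (c := (-1)%:C) lv).
  move: h; rewrite /mu !(spec_diag_rip E mK lD, spec_diag_rip E mKC lD).
  rewrite !(spec_diag_rip E mK lB, spec_diag_rip E mKC lB).
  by rewrite -!EFinD => -[] /addrI ->.
- by move=> n; apply: fin_mu => //; apply: mpre; exact: measurable_itv.
Qed.

End Growth.

(** * Alternating Jacobi words and lattice paths *)

Section Paths.
Context {R : realType}.
Variables (a : nat -> R) (b : nat -> R[i]).
Hypothesis a_gt0 : forall n, 0 < a n.

Definition conj_seq (u : cseq R) : cseq R := fun n => conjc (u n).

(** The adjoint acts as the Jacobi matrix with conjugated diagonal, so conjugating at odd steps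
    alternates [J] and [J^*]. *)
Definition jacobi_diag (j : nat) : nat -> R[i] :=
  if odd j then conj_seq b else b.

(* [jacobi_word (2k) = (J^* J)^k delta_0] and
   [jacobi_word (2k+1) = J (J^* J)^k delta_0]. *)
Fixpoint jacobi_word (j : nat) : cseq R :=
  if j is j'.+1 then jacobi_seq a (jacobi_diag j') (jacobi_word j')
  else delta 0.

Lemma jacobi_wordS j :
  jacobi_word j.+1 = jacobi_seq a (jacobi_diag j) (jacobi_word j).
Proof. by []. Qed.

(** Height [j] is reached in [j] steps only by the path that always goes up; its weight is a product
    of entries of [a]. *)
Lemma jacobi_word_top j :
  (forall n, (j < n)%N -> jacobi_word j n = 0) /\
  exists2 r : R, 0 < r & jacobi_word j j = r%:C.
Proof.
elim: j => [|j [IH0 [r r0 IHr]]].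
  split; first by case.
  by exists 1; rewrite ?ltr01 // /= /delta eqxx.
split.
  move=> n jn; rewrite /= /jacobi_seq.
  rewrite (IH0 n) ?(IH0 n.+1) ?mulr0 ?addr0 //; try lia.
  by case: n jn => // n jn; rewrite IH0 ?mulr0 //; lia.
exists (a j * r); first by rewrite mulr_gt0.
rewrite /= /jacobi_seq IHr (IH0 j.+1) // (IH0 j.+2) //.
by rewrite !mulr0 !addr0 rmorphM.
Qed.

(** [good] is the property sought for the coefficients, and [vanish e] a property of word entries
    whose length plus height has parity [e], which is the parity of the number of flat steps. Two
    instances are used: both mean being real; or [good] and [vanish true] mean being zero and
    [vanish false] is no condition. *)
Variables (vanish : bool -> R[i] -> Prop) (good : R[i] -> Prop).
Hypotheses
  (vanish0 : forall e, vanish e 0)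
  (vanishD : forall e x y, vanish e x -> vanish e y -> vanish e (x + y))
  (vanishZ : forall e (r : R) x, vanish e x -> vanish e (r%:C * x))
  (vanish1 : vanish false 1)
  (vanish_good : forall e c x, good c -> vanish e x -> vanish (~~ e) (c * x))
  (good_vanish : forall c, vanish true c -> good c)
  (good_conj : forall c, good c -> good (conjc c)).

(** A path with a flat step at height [h] that ends at [n] has length at least [2h + 1 - n], so
    under [j + n <= 2m] flat steps occur only below [m]. *)
Lemma jacobi_word_vanish m : (forall n, (n < m)%N -> good (b n)) ->
  forall j n, (j + n <= m.*2)%N -> vanish (odd (j + n)) (jacobi_word j n).
Proof.
move=> hb; elim=> [|j IH] n jn.
  rewrite /= /delta add0n; case: n jn => [|n] _ //=.
rewrite [jacobi_word _]/= /jacobi_seq; apply: vanishD; first apply: vanishD.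
- case: n jn => [|n] jn; first exact: vanish0.
  by apply: vanishZ; rewrite addSnnS !addnS /= negbK; apply: IH; lia.
- have [nm|mn] := ltnP n m.
    rewrite addSn /=; apply: vanish_good; last by apply: IH; lia.
    by rewrite /jacobi_diag; case: ifP => _; rewrite /conj_seq; auto.
  by rewrite (jacobi_word_top j).1 ?mulr0 //; lia.
- by apply: vanishZ; rewrite addSnnS; apply: IH; lia.
Qed.

(* Up to vanishing terms, the only path of length [2m+1] from [0] to [0] that
   contributes is the one making its flat step at height [m]. *)
Lemma jacobi_word_return m : (forall n, (n < m)%N -> good (b n)) ->
  forall i, (i <= m)%N -> exists2 r : R, 0 < r &
    vanish true (jacobi_diag m m - r%:C * jacobi_word (m.+1 + i)%N (m - i)%N).
Proof.
move=> hb; have hv := jacobi_word_vanish hb; elim=> [|i IH] im.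
  have [w0 [r r0 wr]] := jacobi_word_top m.
  (* Base case: the flat step at height [m] follows [m] steps up of weight [r], which is divided
     out. *)
  exists r^-1; rewrite ?invr_gt0 // addn0 subn0 [jacobi_word _]/= /jacobi_seq wr.
  rewrite (w0 m.+1) // mulr0 addr0 mulrDr opprD addrCA.
  have -> : r^-1%:C * (jacobi_diag m m * r%:C) = jacobi_diag m m.
    by rewrite mulrCA -rmorphM /= mulVf ?mulr1 // gt_eqF.
  rewrite subrr addr0 -mulNr -rmorphN /=; apply: vanishZ.
  move: (hv m); case: {+}m => [|k] h; first exact: vanish0.
  apply: vanishZ; have := h k.
  by rewrite addSn /= addnn odd_double; apply; lia.
have [r r0 h] := IH (ltnW im).
set k := (m - i.+1)%N; have ek : (m - i)%N = k.+1 by rewrite /k; lia.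
have ak : (a k)%:C != 0 :> R[i].
  by rewrite -[0]/(0%:C) (inj_eq (@complexI R)) gt_eqF.
(* One more step down, from [k + 1] to [k], multiplies the weight by [a k]. *)
exists (r / a k); first by rewrite divr_gt0.
rewrite addnS jacobi_wordS /jacobi_seq -ek.
set w := jacobi_word _.
rewrite mulrDr opprD addrCA.
have -> : (r / a k)%:C * ((a k)%:C * w (m - i)%N) = r%:C * w (m - i)%N.
  by rewrite mulrA -rmorphM /= divfK // gt_eqF.
apply: vanishD => //; rewrite -mulNr -rmorphN; apply: vanishZ.
apply: vanishD.
  have := hv (m.+1 + i)%N k.-1; rewrite -/w.
  case: {+}k ek => [|k'] ek h'; first exact: vanish0.
  apply: vanishZ; have -> : true = odd (m.+1 + i + k') by lia.
  by apply: h'; lia.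
apply: (@vanish_good false).
  have hk : good (b k) by apply: hb; lia.
  by rewrite /jacobi_diag /conj_seq; case: ifP => _; [exact: good_conj|].
have -> : false = odd (m.+1 + i + k) by lia.
by apply: hv; lia.
Qed.

Lemma jacobi_word_good :
  (forall k, vanish true (jacobi_word k.*2.+1 0%N)) -> forall m, good (b m).
Proof.
move=> hw m; elim/ltn_ind: m => m IH.
have [r r0] := jacobi_word_return IH (leqnn m).
rewrite subnn addSn addnn => h.
have : vanish true (jacobi_diag m m).
  rewrite -[jacobi_diag m m](subrK (r%:C * jacobi_word m.*2.+1 0%N)).
  by apply: vanishD => //; apply: vanishZ.
move=> /good_vanish; rewrite /jacobi_diag; case: ifP => // _ /good_conj.
by rewrite /conj_seq conjcK.
Qed.

End Paths.

(** * Adjoints of Jacobi operators and self-adjointness for real coefficients *)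

Section JacobiOperators.
Context {R : realType}.
Variables (a : nat -> R) (b : nat -> R[i]).
Implicit Types u v w x y : cseq R.

Let J := jacobi_seq a b.
Let J' := jacobi_seq a (conj_seq b).

Definition finsupp u := exists N, forall n, (N <= n)%N -> u n = 0.

Lemma finsupp_ell2 u : finsupp u -> ell2 u.
Proof. by move=> [N]; exact: ell2_finsupp. Qed.

Lemma finsupp_delta k : finsupp (delta k : cseq R).
Proof. by exists k.+1 => n kn; rewrite /delta gtn_eqF. Qed.

Lemma finsupp_jacobi (c : nat -> R[i]) u : finsupp u -> finsupp (jacobi_seq a c u).
Proof.
move=> [N hN]; exists N.+1 => -[|n] // Nn; rewrite /jacobi_seq.
by rewrite !hN ?mulr0 ?addr0 //; lia.
Qed.

Lemma conjcD (y z : R[i]) : conjc (y + z) = conjc y + conjc z.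
Proof. exact: rmorphD. Qed.

Lemma conjcM (y z : R[i]) : conjc (y * z) = conjc y * conjc z.
Proof. exact: rmorphM. Qed.

(** Discrete Green identity: conjugating [b] in [J'] cancels the diagonal terms, and the rest
    telescopes to a boundary term. *)
Lemma green_jacobi u x N :
  \sum_(0 <= n < N.+1) (conjc (u n) * J x n - conjc (J' u n) * x n) =
  (a N)%:C * (conjc (u N) * x N.+1 - conjc (u N.+1) * x N).
Proof.
elim: N => [|N IH].
  rewrite big_nat1 /J /J' /jacobi_seq /conj_seq.
  by rewrite !(conjcD, conjcM, conjc_real, conjc0, conjcK); ring.
rewrite big_nat_recr //= IH /J /J' /jacobi_seq /conj_seq.
by rewrite !(conjcD, conjcM, conjc_real, conjc0, conjcK); ring.
Qed.

Lemma limn_series_finsupp (f g : nat -> R) N :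
  (forall n, (N <= n)%N -> f n = 0) -> (forall n, (N <= n)%N -> g n = 0) ->
  \sum_(0 <= n < N) f n = \sum_(0 <= n < N) g n ->
  limn (series f) = limn (series g).
Proof.
move=> hf hg e.
have h (k : nat -> R) : (forall n, (N <= n)%N -> k n = 0) ->
    limn (series k) = \sum_(0 <= n < N) k n.
  move=> hk; apply: (@limn_series_eventually _ _ _ N) => n Nn.
  rewrite /series /= (@big_cat_nat _ _ _ N) //= [X in _ + X]big1_seq ?addr0 //.
  by move=> i; rewrite mem_index_iota => /andP[_ /andP[Ni _]]; exact: hk.
by rewrite !h.
Qed.

Lemma inner_jacobi u x : finsupp u \/ finsupp x ->
  inner u (J x) = inner (J' u) x.
Proof.
move=> hux.
have [N [h1 h2 h3]] : exists N,
    [/\ forall n, (N <= n)%N -> conjc (u n) * J x n = 0,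
     forall n, (N <= n)%N -> conjc (J' u n) * x n = 0 &
     (forall n, (N <= n)%N -> u n = 0) \/ (forall n, (N <= n)%N -> x n = 0)].
  case: hux => [hu|hx].
    have [N1 h1] := hu; have [N2 h2] := finsupp_jacobi (conj_seq b) hu.
    exists (maxn N1 N2); split=> [n Nn|n Nn|]; last left => n Nn.
    - by rewrite h1 ?conjc0 ?mul0r //; lia.
    - by rewrite [J' u n]h2 ?conjc0 ?mul0r //; lia.
    - by rewrite h1 //; lia.
  have [N1 h1] := hx; have [N2 h2] := finsupp_jacobi b hx.
  exists (maxn N1 N2); split=> [n Nn|n Nn|]; last right => n Nn.
  - by rewrite [J x n]h2 ?mulr0 //; lia.
  - by rewrite h1 ?mulr0 //; lia.
  - by rewrite h1 //; lia.
(* The boundary term of this sum sits at [N + 1] and [N + 2], beyond the support of one of the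
   vectors. *)
have e : \sum_(0 <= n < N.+2) conjc (u n) * J x n =
    \sum_(0 <= n < N.+2) conjc (J' u n) * x n.
  apply/eqP; rewrite -subr_eq0 -sumrB green_jacobi.
  by case: h3 => h3; rewrite !h3 ?conjc0 ?mul0r ?mulr0 ?subr0 ?mulr0 //; lia.
have hR : {morph (@complex.Re R) : y z / y + z} by move=> y z; exact: cReD.
have hI : {morph (@complex.Im R) : y z / y + z} by move=> y z; exact: cImD.
rewrite /inner; congr (_ +i* _).
  apply: (@limn_series_finsupp _ _ N.+2) => [n Nn|n Nn|].
  - by rewrite h1 //; lia.
  - by rewrite h2 //; lia.
  - by rewrite -!(big_morph _ hR (erefl (0 : R) : complex.Re (0 : R[i]) = 0)) e.
apply: (@limn_series_finsupp _ _ N.+2) => [n Nn|n Nn|].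
- by rewrite h1 //; lia.
- by rewrite h2 //; lia.
- by rewrite -!(big_morph _ hI (erefl (0 : R) : complex.Im (0 : R[i]) = 0)) e.
Qed.

Lemma jacobi_finsupp u : finsupp u -> jacobi a b (u, J u).
Proof.
by move=> hu; split=> //; apply: finsupp_ell2 => //; exact: finsupp_jacobi.
Qed.

Lemma adjoint_finsupp u : finsupp u -> adjoint (jacobi a b) (u, J' u).
Proof.
move=> hu; split => /=; [exact: finsupp_ell2|exact/finsupp_ell2/finsupp_jacobi|].
by move=> x w [/= _ _ ->]; apply: inner_jacobi; left.
Qed.

Lemma op_comp_finsupp u : finsupp u ->
  op_comp (adjoint (jacobi a b)) (jacobi a b) (u, J' (J u)).
Proof.
move=> hu; exists (J u) => /=; first exact: jacobi_finsupp.
exact/adjoint_finsupp/finsupp_jacobi.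
Qed.

Lemma inner_deltar k u : inner u (delta k) = conjc (u k).
Proof.
apply: complex_ext; rewrite ?Im_inner ?cReJ ?cImJ.
  by rewrite -/(rip u _) ripC /rip inner_delta.
by rewrite ripC /rip inner_delta /=; case: (u k) => y z /=; ring.
Qed.

(** Basis vectors lie in the domain of [J]; testing against them determines each entry of [w]. *)
Lemma adjoint_jacobiE u w : adjoint (jacobi a b) (u, w) -> w = J' u.
Proof.
move=> [/= hu hw h]; apply/funext => n; have hd := finsupp_delta n.
have := h _ _ (jacobi_finsupp hd); rewrite inner_jacobi; last by right.
by rewrite !inner_deltar => /(can_inj (@conjcK R)).
Qed.

(** The adjoint sends [delta n] to [J' (delta n)]; its [n]-th entry must equal that of
    [J (delta n)], so [b n] equals its conjugate. *)
Lemma self_adjoint_real : self_adjoint (jacobi a b) ->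
  forall n, complex.Im (b n) = 0.
Proof.
move=> sa n; have hd := finsupp_delta n.
have := adjoint_finsupp hd; rewrite sa => -[_ _ /= /(congr1 (@^~ n))].
rewrite /J' /jacobi_seq /conj_seq /delta.
rewrite [in X in X -> _]eqxx [n.+1 == n]gtn_eqF // !mulr0 !addr0 !mulr1.
case: n {hd} => [|n]; rewrite ?(ltn_eqF (ltnSn n)) ?mulr0 ?add0r.
  by move=> /(congr1 (@complex.Im R)); rewrite cImJ; lra.
by move=> /(congr1 (@complex.Im R)); rewrite cImJ; lra.
Qed.

Lemma conj_seq_real : (forall n, complex.Im (b n) = 0) -> conj_seq b = b.
Proof.
move=> hb; apply/funext => n; apply: complex_ext; rewrite ?cReJ ?cImJ //.
by rewrite hb oppr0.
Qed.

Lemma jacobi_seqZ (c : R[i]) u : J (c \*o u) = c \*o J u.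
Proof. by apply/funext => -[|n]; rewrite /J /jacobi_seq /=; ring. Qed.

(** Properness approximates [(x, w)] in the graph by finitely supported pairs, for which the Green
    identity holds without boundary term; Young's inequality controls the error. *)
Lemma proper_rip_le u x w : (forall n, complex.Im (b n) = 0) ->
  proper_jacobi a b -> jacobi a b (u, J u) -> jacobi a b (x, w) ->
  rip u w <= rip (J u) x.
Proof.
move=> hb hp [/= hu hJu _] hxw; rewrite -subr_le0.
have [/= hx hw _] := hxw.
set d := _ - _; rewrite leNgt; apply/negP => d0.
(* With precision [e = d / M], the two errors add up to at most [e] times the squared norms of [u]
   and [J u], plus [2 e]; this gives [2 d <= e * M = d], which contradicts [0 < d]. *)
set M := rip u u + rip (J u) (J u) + 2.
have M0 : 0 < M by rewrite ltr_wpDl // addr_ge0 ?rip_ge0.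
have e0 : 0 < d / M by rewrite divr_gt0.
move: hxw; rewrite -hp => -[/= _ _ /(_ _ e0)] [[y z]] [[/= hy hz ez] fy] /= [dy dz].
have hxy := ell2B hx hy; have hwz := ell2B hw hz.
have hNJ := ell2Z (c := (-1)%:C) hJu.
have Ny := rip_lt_l2norm e0 hxy dy; have Nz := rip_lt_l2norm e0 hwz dz.
have s1 := ler_rip e0 hu hwz; have s2 := ler_rip e0 hNJ hxy.
have green : rip u z = rip (J u) y.
  rewrite /rip ez inner_jacobi; last by right.
  by rewrite /J' conj_seq_real.
have b1 : (d / M)^-1 * rip (w \- z) (w \- z) <= d / M.
  by rewrite mulrC ler_pdivrMr // -expr2 ltW.
have b2 : (d / M)^-1 * rip (x \- y) (x \- y) <= d / M.
  by rewrite mulrC ler_pdivrMr // -expr2 ltW.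
have s3 : 2 * d <= d / M * M.
  move: s1 s2 b1 b2; rewrite !ripBr // !(ripZl _ hJu) // !(ripZr _ hJu hJu).
  rewrite green; move: (d / M) => e; rewrite /M /d => s1 s2 b1 b2.
  by lra.
by move: s3; rewrite divfK ?gt_eqF //; lra.
Qed.

Lemma proper_self_adjoint : (forall n, complex.Im (b n) = 0) ->
  proper_jacobi a b -> self_adjoint (jacobi a b).
Proof.
move=> hb hp; apply/seteqP; split=> -[u w].
  move=> huw; have [/= hu hw _] := huw; split => //=.
  by rewrite (adjoint_jacobiE huw) /J' conj_seq_real.
move=> huw; have [/= hu hw] := huw; rewrite -/J => ew; split=> //= x y hxy.
have [/= hx hy _] := hxy.
have le c : rip (c \*o u) y <= rip (c \*o w) x.
  rewrite ew -jacobi_seqZ; apply: proper_rip_le => //; split => //=.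
    exact: ell2Z.
  by rewrite -/J jacobi_seqZ -ew; exact: ell2Z.
(* The inequality for [- c] is the reverse one for [c]; then [c = 1] and [c = 'i] yield the real and
   imaginary parts. *)
have eq c : rip (c \*o u) y = rip (c \*o w) x.
  have hcu := ell2Z (c := c) hu; have hcw := ell2Z (c := c) hw.
  have eN v : (- c) \*o v = (-1)%:C \*o (c \*o v) :> cseq R.
    by apply/funext => n /=; rewrite rmorphN1; ring.
  apply/eqP; rewrite eq_le le /=.
  by have := le (- c); rewrite !eN !ripZl // !mulN1r lerN2.
apply: complex_ext; last by rewrite !Im_inner eq.
have e1 v : 1 \*o v = v :> cseq R by apply/funext => n /=; rewrite mul1r.
by have := eq 1; rewrite !e1.
Qed.

End JacobiOperators.

(** * Almost everywhere vanishing from weighted integrals on the half-line *)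

Section HalfLine.
Context {R : realType}.
Variable nu : probability (measurableTypeR R) R.
Let D : set (measurableTypeR R) := `[0, +oo[%classic.

Lemma ae_mono (P Q : R -> Prop) : {ae nu, forall s, P s} ->
  (forall s, P s -> Q s) -> {ae nu, forall s, Q s}.
Proof. by move=> h PQ; apply: (@filterS _ _ (ae_filter_ringOfSetsType nu)) h. Qed.

Lemma ae_mono2 (P Q S : R -> Prop) : {ae nu, forall s, P s} ->
  {ae nu, forall s, Q s} -> (forall s, P s -> Q s -> S s) ->
  {ae nu, forall s, S s}.
Proof.
move=> hP hQ PQ.
exact: (@filterS2 _ _ (ae_filter_ringOfSetsType nu) _ _ _ PQ hP hQ).
Qed.

Lemma measurable_weighted (A : set (measurableTypeR R)) (g : R -> R) :
  measurable A -> measurable_fun D g ->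
  measurable_fun D (fun s : measurableTypeR R => s * \1_A s * g s).
Proof.
move=> mA mg; by apply: measurable_funM => //; apply: measurable_funM.
Qed.

Lemma Rintegral_weighted_ae0 (A : set (measurableTypeR R)) (g : R -> R) :
  measurable A -> measurable_fun D g ->
  {ae nu, forall s, 0 <= s -> g s = 0} ->
  \int[nu]_(s in D) (s * \1_A s * g s) = 0.
Proof.
move=> mA mg g0; rewrite /Rintegral.
rewrite (ae_eq_integral (cst 0%E)) ?integral0 //.
- exact: measurable_itv.
- by apply/measurable_EFinP; exact: measurable_weighted.
- apply: (ae_mono g0) => s h; rewrite /D /= in_itv /= andbT => s0.
  by rewrite h // mulr0.
Qed.

(** Test on the sets where [0 < g <= 1] and [s <= n]: there the integrand is nonnegative and
    bounded, so a zero integral makes it vanish almost everywhere. *)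
Lemma ae_le0_weighted (g : R -> R) : measurable_fun D g ->
  {ae nu, forall s, 0 <= s -> g s <= 1} -> g 0 = 0 ->
  (forall A : set (measurableTypeR R), measurable A ->
    (forall s, A s -> 0 < g s) -> \int[nu]_(s in D) (s * \1_A s * g s) = 0) ->
  {ae nu, forall s, 0 <= s -> g s <= 0}.
Proof.
move=> mg g1 g00 hA.
have mD : measurable D by exact: measurable_itv.
pose A n : set (measurableTypeR R) := (D `&` g @^-1` `]0, 1]) `&` `]-oo, n%:R].
have mA n : measurable (A n).
  apply: measurableI; last exact: measurable_itv.
  by apply: mg => //; exact: measurable_itv.
pose f n (s : measurableTypeR R) := s * \1_(A n) s * g s.
have f0 n s : D s -> 0 <= f n s.
  rewrite /D /= in_itv /= andbT /f indicE => s0.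
  have [|_] := boolP (s \in A n); last by rewrite mulr0 mul0r.
  rewrite inE /A /= !in_itv /= => -[[_ /andP[/ltW g0 _]] _].
  by rewrite mulr1 mulr_ge0.
have fn n s : D s -> f n s <= n%:R.
  rewrite /D /= in_itv /= andbT /f indicE => s0.
  have [|_] := boolP (s \in A n); last by rewrite mulr0 mul0r.
  rewrite inE /A /= !in_itv /= => -[[_ /andP[/ltW g0 g1']] sn].
  by rewrite mulr1; apply: le_trans sn; rewrite ler_piMr.
have mf n : measurable_fun D (EFin \o f n).
  by apply/measurable_EFinP; exact: measurable_weighted.
have int0 n : (\int[nu]_(s in D) (f n s)%:E = 0)%E.
  have ge0 : (0 <= \int[nu]_(s in D) (f n s)%:E)%E.
    by apply: integral_ge0 => s Ds; rewrite lee_fin f0.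
  (* [hA] concerns the real integral, which also takes the value [0] when the extended one is [+oo];
     the bound by [n] excludes this. *)
  have lty : (\int[nu]_(s in D) (f n s)%:E < +oo)%E.
    apply: (@le_lt_trans _ _ (\int[nu]_(s in D) cst n%:R%:E s)%E).
      apply: ge0_le_integral => //.
      - by move=> s Ds; rewrite lee_fin f0.
      - exact: mf.
      - by move=> s Ds; rewrite lee_fin fn.
    rewrite integral_cst // lte_mul_pinfty ?lee_fin ?ler0n //.
    by apply: le_lt_trans (probability_le1 nu mD) _; rewrite ltry.
  have gA s : A n s -> 0 < g s.
    by rewrite /A /= !in_itv /= => -[[_ /andP[]]].
  have := hA (A n) (mA n) gA; rewrite /Rintegral -/(f n).
  by case: (integral _ _ _) ge0 lty => //= r _ _ ->.
have aef : {ae nu, forall s, forall n, D s -> f n s = 0}.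
  apply: ae_foralln => n.
  have := (ae_eq_integral_abs nu mD (mf n)).1.
  rewrite (eq_integral (fun s => (f n s)%:E)) => [/(_ (int0 n))|s].
    by move=> h; apply: (ae_mono h) => s hs Ds; have [] := hs Ds.
  by rewrite inE => Ds /=; rewrite ger0_norm // f0.
apply: (ae_mono2 aef g1) => s hf {}g1 s0; rewrite leNgt; apply/negP => gs.
have Ds : D s by rewrite /D /= in_itv /= andbT.
(* The weight [s] vanishes at the origin, so that point is settled by [g 0 = 0]. *)
have sp : 0 < s.
  rewrite lt_neqAle s0 andbT; apply/eqP => e.
  by move: gs; rewrite -e g00 ltxx.
have := hf (Num.trunc s).+1 Ds; rewrite /f indicE mem_set.
  by rewrite mulr1 => /eqP; rewrite mulf_eq0 !gt_eqF.
rewrite /A /= !in_itv /= gs g1 //; do !split => //.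
exact/ltW/truncnS_gt.
Qed.

(** The one-sided statement is applied to [g] and to [- g]. *)
Lemma ae_eq0_weighted (g : R -> R) : measurable_fun D g ->
  {ae nu, forall s, 0 <= s -> `|g s| <= 1} -> g 0 = 0 ->
  (forall A : set (measurableTypeR R), measurable A ->
    \int[nu]_(s in D) (s * \1_A s * g s) = 0) ->
  {ae nu, forall s, 0 <= s -> g s = 0}.
Proof.
move=> mg g1 g00 hA.
have le0 : {ae nu, forall s, 0 <= s -> g s <= 0}.
  apply: ae_le0_weighted => // [|A mA _]; last exact: hA.
  by apply: (ae_mono g1) => s h s0; apply: le_trans (ler_norm _) (h s0).
have ge0 : {ae nu, forall s, 0 <= s -> - g s <= 0}.
  apply: ae_le0_weighted; rewrite ?g00 ?oppr0 //.
  - exact: measurableT_comp.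
  - apply: (ae_mono g1) => s h s0; apply: le_trans (h s0).
    by rewrite -normrN ler_norm.
  - move=> A mA gA; have := hA A mA; rewrite /Rintegral.
    rewrite (eq_integral (fun s : measurableTypeR R =>
      - (s * \1_A s * - g s)%:E)%E); last first.
      by move=> s _; rewrite mulrN EFinN oppeK.
    rewrite integral_ge0N; last first.
      move=> s; rewrite /D /= in_itv /= andbT => s0; rewrite lee_fin indicE.
      have [|_] := boolP (s \in A); last by rewrite mulr0 mul0r.
      by rewrite inE => /gA /ltW gs; rewrite mulr1 mulr_ge0.
    by rewrite fineN => /eqP; rewrite oppr_eq0 => /eqP.
apply: (ae_mono2 le0 ge0) => s h1 h2 s0; apply/eqP; rewrite eq_le h1 //=.
by rewrite -oppr_le0 h2.
Qed.

End HalfLine.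

(** * Translation between spectral data and coefficients *)

Section SpectralData.
Context {R : realType}.
Variables (a : nat -> R) (b : nat -> R[i])
  (nu : probability (measurableTypeR R) R)
  (psi : R -> R[i]) (T : set (cseq R * cseq R)) (E : spectral_measure R).
Hypotheses (a_gt0 : forall n, 0 < a n) (hproper : proper_jacobi a b)
  (psi_meas : cmeasurable `[0, +oo[ psi)
  (psi_le1 : {ae nu, forall s, 0 <= s -> Normc.normc (psi s) <= 1})
  (psi0 : psi 0 = 0)
  (T_modulus : is_modulus (jacobi a b) T) (ET : is_spectral_measure_of T E)
  (data : forall f, bounded_borel f -> exists w x,
          [/\ spec_integral E f (delta 0, w), jacobi a b (w, x),
              inner (delta 0) w = cintegral nu `[0, +oo[ f
            & inner (delta 0) x =
                cintegral nu `[0, +oo[ (fun s => s%:C * f s * psi s)]).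

Local Opaque ell2.
Let D : set (measurableTypeR R) := `[0, +oo[%classic.
Let P := spec_proj E.
Let J := jacobi_seq a b.
Let J' := jacobi_seq a (conj_seq b).
Let d0 : cseq R := delta 0.
Let v0 := J' d0.

Let opT : is_operator T. Proof. by case: T_modulus. Qed.

Let op_compT : op_comp T T = op_comp (adjoint (jacobi a b)) (jacobi a b).
Proof. by case: T_modulus. Qed.

Lemma finsupp_v0 (c : R[i]) : finsupp (c \*o v0).
Proof.
have [N h] := finsupp_jacobi a (conj_seq b) (finsupp_delta (R := R) 0).
by exists N => n Nn /=; rewrite /v0 /J' h // mulr0.
Qed.

Lemma finsupp_iter k : finsupp (iter k (fun u => J' (J u)) d0).
Proof.
elim: k => [|k IH]; first exact: finsupp_delta.
by do 2!apply: finsupp_jacobi.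
Qed.

Lemma smooth_finsupp (u : cseq R) : finsupp u -> smooth T u.
Proof.
move=> hu; exists (fun n => iter n (fun u => J' (J u)) u) => // n.
rewrite op_compT; apply: op_comp_finsupp.
elim: n => //= n IH; by do 2!apply: finsupp_jacobi.
Qed.

(** Take [f = \1_A] in the data: then [w = P A d0], and moving [J] across the inner product replaces
    [d0] by [v0], which is [J^* delta_0]. *)
Lemma data_formula (A : set (measurableTypeR R)) (c : R[i]) : measurable A ->
  rip (c \*o v0) (P A d0) =
  complex.Re c * \int[nu]_(s in D) (s * \1_A s * complex.Re (psi s)) +
  complex.Im c * \int[nu]_(s in D) (s * \1_A s * complex.Im (psi s)).
Proof.
move=> mA.
have hf : bounded_borel (fun s => (\1_A s)%:C).
  split; last first.
    exists 1 => s; rewrite indicE; case: (_ \in _) => /=.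
      by rewrite expr0n addr0 expr1n sqrtr1.
    by rewrite expr0n addr0 sqrtr0 ler01.
  by split => /=; [exact: measurable_indic|exact: measurable_cst].
have [w [x [hw hJ _ hx]]] := data hf.
have lx : ell2 d0 by exact/finsupp_ell2/finsupp_delta.
have ew : w = P A d0 by apply: spec_integral_indic hw.
have := adjoint_finsupp a b (finsupp_delta (R := R) 0).
move=> [/= _ lv0 /(_ _ _ hJ)]; rewrite hx ew -/J' -/d0 -/v0 => e.
have lP : ell2 (P A d0) by exact: spec_proj_ell2.
rewrite (rip_scale _ lv0 lP) -e cReM cReJ cImJ mulNr opprK /=.
congr (_ * _ + _ * _); apply: eq_Rintegral => s _; rewrite !ReImE /=; ring.
Qed.

Lemma measurable_Re : measurable_fun D (fun s => complex.Re (psi s)).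
Proof. by case: psi_meas. Qed.

Lemma measurable_Im : measurable_fun D (fun s => complex.Im (psi s)).
Proof. by case: psi_meas. Qed.

(** [A] and the symmetric set of all [s] with [|s|] in [A] have the same trace on the half-line, so
    symmetric sets suffice to determine the integrals. *)
Lemma vanishing_of_antisym (V : cseq R -> cseq R) (c : R[i]) (g : R -> R) :
  (forall u, ell2 u -> ell2 (V u)) ->
  (forall u v, rip (V u) v = rip u (V v)) ->
  (forall u, V (V u) = u) ->
  (forall u w, op_comp T T (u, w) -> op_comp T T (V u, V w)) ->
  V d0 = d0 -> V (c \*o v0) = (-1)%:C \*o (c \*o v0) ->
  measurable_fun D g ->
  {ae nu, forall s, 0 <= s -> `|g s| <= 1} -> g 0 = 0 ->
  (forall A : set (measurableTypeR R), measurable A ->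
    rip (c \*o v0) (P A d0) = \int[nu]_(s in D) (s * \1_A s * g s)) ->
  {ae nu, forall s, 0 <= s -> g s = 0}.
Proof.
move=> V_ell2 V_sym V_inv V_S Vd0 Vv0 mg g1 g0 hg.
apply: ae_eq0_weighted => // A mA.
have anti := rip_proj_abs_antisym opT ET V_ell2 V_sym V_inv V_S
  (smooth_finsupp (finsupp_delta 0)) (smooth_finsupp (finsupp_v0 c)) Vd0 Vv0 mA.
have mabsA : measurable ([set s : R | A `|s|] : set (measurableTypeR R)).
  pose abs : measurableTypeR R -> measurableTypeR R := Num.norm.
  have mabs : measurable_fun setT abs by exact: normr_measurable.
  by rewrite -[X in measurable X]setTI; exact: mabs.
rewrite -[RHS]anti hg //; apply: eq_Rintegral => s.
rewrite inE /D /= in_itv /= andbT => s0; congr (_ * _ * _).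
by rewrite !indicE; congr (_%:R); apply: congr1; apply/idP/idP;
  rewrite !inE /= ger0_norm.
Qed.

(** Each factor [J^* J = T^2] preserves orthogonality by two uses of [spec_graph_orth]. At
    [A = setT], moving [J] back from [v0] gives the [(0, 0)] entry of the odd word. *)
Lemma word_of_vanishing (c : R[i]) :
  (forall A : set (measurableTypeR R), measurable A ->
    rip (c \*o v0) (P A d0) = 0) ->
  forall k, complex.Re (conjc c * jacobi_word a b k.*2.+1 0%N) = 0.
Proof.
move=> h k.
have hm : spec_moment E (c \*o v0).
  have [x <- hx] := smooth_finsupp (finsupp_v0 c).
  by have [t /= /(operator_moment ET)] := hx 0%N.
pose x n := iter n (fun u => J' (J u)) d0.
have wE n : jacobi_word a b n.*2 = x n /\ jacobi_word a b n.*2.+1 = J (x n).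
  elim: n => [|n [_ IH]]; first by [].
  suff e : jacobi_word a b n.+1.*2 = x n.+1.
    by split=> //; rewrite jacobi_wordS e /jacobi_diag odd_double.
  by rewrite doubleS jacobi_wordS IH /jacobi_diag /= odd_double.
have orth n : forall A : set (measurableTypeR R), measurable A ->
    rip (c \*o v0) (P A (x n)) = 0.
  elim: n => // n IH.
  have : op_comp T T (x n, x n.+1).
    by rewrite op_compT; apply: op_comp_finsupp; exact: finsupp_iter.
  move=> [t /=]; rewrite -ET => h1 h2.
  by apply: spec_graph_orth h2 => //; apply: spec_graph_orth h1.
have := orth k setT measurableT.
have hx := finsupp_iter k; have lx := finsupp_ell2 hx.
rewrite /P spec_projT // (wE k).2.
have e1 : inner v0 (x k) = J (x k) 0%N.
  rewrite /v0 /d0 -[J' _]/(jacobi_seq a (conj_seq b) _) -inner_jacobi.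
    by rewrite inner_delta.
  by right.
have lv0 := finsupp_ell2 (finsupp_jacobi a (conj_seq b) (finsupp_delta (R := R) 0)).
by rewrite rip_scale // e1.
Qed.

Lemma vanishing_word (c : R[i]) (g : R -> R) :
  measurable_fun D g ->
  (forall A : set (measurableTypeR R), measurable A ->
    rip (c \*o v0) (P A d0) = \int[nu]_(s in D) (s * \1_A s * g s)) ->
  {ae nu, forall s, 0 <= s -> g s = 0} ->
  forall k, complex.Re (conjc c * jacobi_word a b k.*2.+1 0%N) = 0.
Proof.
move=> mg hg g0; apply: word_of_vanishing => A mA.
by rewrite hg //; exact: Rintegral_weighted_ae0.
Qed.

Lemma rip_Im (A : set (measurableTypeR R)) : measurable A ->
  rip ('i \*o v0) (P A d0) =
  \int[nu]_(s in D) (s * \1_A s * complex.Im (psi s)).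
Proof. by move=> mA; rewrite data_formula //= mul0r add0r mul1r. Qed.

Lemma rip_Re (A : set (measurableTypeR R)) : measurable A ->
  rip (1 \*o v0) (P A d0) =
  \int[nu]_(s in D) (s * \1_A s * complex.Re (psi s)).
Proof. by move=> mA; rewrite data_formula //= mul0r addr0 mul1r. Qed.

Lemma Im_psi_le1 : {ae nu, forall s, 0 <= s -> `|complex.Im (psi s)| <= 1}.
Proof.
apply: (ae_mono psi_le1) => s h s0; apply: le_trans (h s0).
case: (psi s) => x y /=; rewrite -sqrtr_sqr ler_wsqrtr //.
by rewrite lerDr sqr_ge0.
Qed.

Lemma Re_psi_le1 : {ae nu, forall s, 0 <= s -> `|complex.Re (psi s)| <= 1}.
Proof.
apply: (ae_mono psi_le1) => s h s0; apply: le_trans (h s0).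
case: (psi s) => x y /=; rewrite -sqrtr_sqr ler_wsqrtr //.
by rewrite lerDl sqr_ge0.
Qed.

Lemma real_coeff_of_psi : {ae nu, forall s, 0 <= s -> complex.Im (psi s) = 0} ->
  forall n, complex.Im (b n) = 0.
Proof.
move=> h; apply: (jacobi_word_good a_gt0 (vanish := fun _ x => complex.Im x = 0)
  (good := fun x => complex.Im x = 0)) => //.
- by move=> _ x y hx hy; rewrite cImD hx hy addr0.
- by move=> _ r x hx; rewrite cImM hx /= mulr0 mul0r addr0.
- by move=> _ c x hc hx; rewrite cImM hc hx mulr0 mul0r addr0.
- by move=> c hc; rewrite cImJ hc oppr0.
move=> k; have := vanishing_word measurable_Im rip_Im h k.
by rewrite cReM /=; lra.
Qed.

Lemma null_coeff_of_psi : {ae nu, forall s, 0 <= s -> psi s = 0} ->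
  forall n, b n = 0.
Proof.
move=> h.
apply: (jacobi_word_good a_gt0 (vanish := fun e x => if e then x = 0 else True)
  (good := fun x => x = 0)) => //.
- by case.
- by case=> // x y -> ->; rewrite addr0.
- by case=> // r x ->; rewrite mulr0.
- by case=> // c x ->; rewrite mul0r.
- by move=> c ->; rewrite conjc0.
move=> k; apply: complex_ext.
  have hRe : {ae nu, forall s, 0 <= s -> complex.Re (psi s) = 0}.
    by apply: (ae_mono h) => s e s0; rewrite e.
  by have := vanishing_word measurable_Re rip_Re hRe k; rewrite conjc1 mul1r.
have hIm : {ae nu, forall s, 0 <= s -> complex.Im (psi s) = 0}.
  by apply: (ae_mono h) => s e s0; rewrite e.
have := vanishing_word measurable_Im rip_Im hIm k.
by rewrite cReM cReJ cImJ; move: (jacobi_word _ _ _ _) => [x y] /=; lra.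
Qed.

Lemma conj_seq_jacobi (c : nat -> R[i]) (u : cseq R) :
  conj_seq (jacobi_seq a c u) = jacobi_seq a (conj_seq c) (conj_seq u).
Proof.
apply/funext => -[|n]; rewrite /conj_seq /jacobi_seq.
  by rewrite !(conjcD, conjcM, conjc_real, conjc0).
by rewrite !(conjcD, conjcM, conjc_real).
Qed.

Lemma conj_seq_delta : conj_seq d0 = d0.
Proof. by apply/funext => n; rewrite /conj_seq /d0 /delta conjc_nat. Qed.

Lemma ell2_normc (u w : cseq R) :
  (forall n, Normc.normc (w n) = Normc.normc (u n)) -> ell2 u -> ell2 w.
Proof.
move=> h hu; apply: (@ell2_le _ 1 u u) => // n.
by rewrite h mul1r lerDl sqr_ge0.
Qed.

Lemma ell2_conj (u : cseq R) : ell2 u -> ell2 (conj_seq u).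
Proof.
apply: ell2_normc => n; rewrite /conj_seq.
by case: (u n) => x y /=; rewrite sqrrN.
Qed.

Lemma psi_real_of_self_adjoint : self_adjoint (jacobi a b) ->
  {ae nu, forall s, 0 <= s -> complex.Im (psi s) = 0}.
Proof.
move=> sa; have hb := conj_seq_real (self_adjoint_real sa).
apply: (vanishing_of_antisym (V := @conj_seq R) (c := 'i)).
- exact: ell2_conj.
- move=> u v; rewrite /rip /=; congr (limn (series _)); apply/funext => n.
  by rewrite /conj_seq !ReImE; ring.
- by move=> u; apply/funext => n; rewrite /conj_seq conjcK.
- move=> u w; rewrite op_compT sa.
  have hJ x y : jacobi a b (x, y) -> jacobi a b (conj_seq x, conj_seq y).
    move=> [/= hx hy e]; split => /=; try exact: ell2_conj.
    by rewrite e conj_seq_jacobi hb.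
  by move=> [v /= /hJ h1 /hJ h2]; exists (conj_seq v).
- exact: conj_seq_delta.
(* Real coefficients make [v0] real, so conjugation changes the sign of ['i \*o v0]. *)
- have e : conj_seq v0 = v0 by rewrite /v0 /J' conj_seq_jacobi !hb conj_seq_delta.
  have en n : conjc (v0 n) = v0 n by exact: (congr1 (@^~ n) e).
  apply/funext => n; rewrite /conj_seq /= conjcM en.
  by apply: complex_ext; rewrite !ReImE /=; ring.
- exact: measurable_Im.
- exact: Im_psi_le1.
- by rewrite psi0.
- exact: rip_Im.
Qed.

(** With zero diagonal [J] is self-adjoint by properness and anticommutes with the signs [V]; hence
    [V] preserves [J^* J = J^2] and reverses [v0 = J delta_0]. The cases [c = 1] and [c = 'i] treat
    the real and imaginary parts of [psi]. *)
Lemma psi_null_of_coeff : (forall n, b n = 0) ->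
  {ae nu, forall s, 0 <= s -> psi s = 0}.
Proof.
move=> b0.
have bI n : complex.Im (b n) = 0 by rewrite b0.
have hb := conj_seq_real bI; have sa := proper_self_adjoint bI hproper.
pose V (u : cseq R) : cseq R := fun n => ((-1) ^+ n)%:C * u n.
have sgn n : (-1) ^+ n * (-1) ^+ n = 1 :> R by rewrite -expr2 sqrr_sign.
have V_ell2 u : ell2 u -> ell2 (V u).
  apply: ell2_normc => n; rewrite /V Normc.normcM.
  by rewrite /= expr0n addr0 expr2 sgn sqrtr1 mul1r.
have VJ u : jacobi_seq a b (V u) = (-1)%:C \*o V (jacobi_seq a b u).
  apply/funext => -[|n]; rewrite /jacobi_seq /V /= !b0 !mul0r.
    by rewrite !exprS !rmorphM /= !rmorphN1 rmorph1; ring.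
  by rewrite !exprS !rmorphM /= !rmorphN1; ring.
have VZ (c : R[i]) u : V (c \*o u) = c \*o V u.
  by apply/funext => n; rewrite /V /=; ring.
have V_inv u : V (V u) = u.
  by apply/funext => n; rewrite /V mulrA -rmorphM sgn mul1r.
have Vd0 : V d0 = d0.
  apply/funext => -[|n]; rewrite /V /d0 /delta; first by rewrite mul1r.
  by rewrite mulr0.
have Vv0 (c : R[i]) : V (c \*o v0) = (-1)%:C \*o (c \*o v0).
  have := VJ d0; rewrite Vd0 => e.
  rewrite VZ; have -> : V v0 = (-1)%:C \*o v0.
    rewrite /v0 /J' hb [in RHS]e; apply/funext => n /=.
    by rewrite rmorphN1; ring.
  by apply/funext => n /=; ring.
have V_sym u v : rip (V u) v = rip u (V v).
  rewrite /rip /=; congr (limn (series _)); apply/funext => n.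
  by rewrite /V !ReImE /=; ring.
have V_S u w : op_comp T T (u, w) -> op_comp T T (V u, V w).
  rewrite op_compT sa => -[v [/= hu hv ev] [/= _ hw ew]].
  have hN x : ell2 x -> ell2 ((-1)%:C \*o V x) by move=> /V_ell2; exact: ell2Z.
  (* The intermediate vector changes sign because [J V = - V J]; the second application of [J]
     restores the sign. *)
  exists ((-1)%:C \*o V v); split => /=.
  - exact: V_ell2.
  - exact: hN.
  - by rewrite VJ ev.
  - exact: hN.
  - exact: V_ell2.
  - rewrite jacobi_seqZ VJ -ew; apply/funext => n /=.
    by rewrite rmorphN1; ring.
have hR : {ae nu, forall s, 0 <= s -> complex.Re (psi s) = 0}.
  apply: (vanishing_of_antisym V_ell2 V_sym V_inv V_S Vd0 (Vv0 1)).
  - exact: measurable_Re.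
  - exact: Re_psi_le1.
  - by rewrite psi0.
  - exact: rip_Re.
have hI : {ae nu, forall s, 0 <= s -> complex.Im (psi s) = 0}.
  apply: (vanishing_of_antisym V_ell2 V_sym V_inv V_S Vd0 (Vv0 'i)).
  - exact: measurable_Im.
  - exact: Im_psi_le1.
  - by rewrite psi0.
  - exact: rip_Im.
by apply: (ae_mono2 hR hI) => s h1 h2 s0; apply: complex_ext; [exact: h1|exact: h2].
Qed.

End SpectralData.

Unset Implicit Arguments.
Set Strict Implicit.

Theorem theorem1p8 (R : realType) (a : nat -> R) (b : nat -> R[i])
    (ha : forall n, 0 < a n) (hproper : proper_jacobi a b)
    (nu : probability (measurableTypeR R) R) (psi : R -> R[i])
    (hdata : is_spectral_data a b nu psi) :
  (self_adjoint (jacobi a b) <->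
     {ae nu, forall s, 0 <= s -> psi s \is Num.real}) /\
  ((forall n, b n = 0) <->
     {ae nu, forall s, 0 <= s -> psi s = 0}).
Proof.
have [_ mpsi psi1 psi0 [T [E [hT hE data]]]] := hdata.
split; split.
- move=> /(psi_real_of_self_adjoint mpsi psi1 psi0 hT hE data) h.
  apply: (ae_mono h) => s hs /hs; case: (psi s) => x y /= ->.
  by rewrite complex_real.
- move=> h; apply: proper_self_adjoint => //.
  apply: (real_coeff_of_psi ha mpsi hT hE data).
  apply: (ae_mono h) => s hs /hs; case: (psi s) => x y.
  by rewrite complex_real => /eqP.
- exact: (psi_null_of_coeff hproper mpsi psi1 psi0 hT hE data).
- exact: (null_coeff_of_psi ha mpsi hT hE data).
Qed.
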